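(* There exists a universal constant $c>0$ such that the following holds. Let $d\ge 1$ be an integer and let $f\in C[0,\pi]$ be a real-valued function, with $0<\|\nabla f\|_{L^2([0,\pi])}<\infty$, that has exactly $d-1$ roots in the open interval $(0,\pi)$. Then $$\sum_{n=1}^{d}\left|\left\langle f,\sin(nx)\right\rangle\right|\;\geq\;\kappa^{-\kappa^2\log\kappa}\,\|f\|_{L^2([0,\pi])},\qquad\text{where}\quad \kappa=c\,\frac{\|\nabla f\|_{L^2([0,\pi])}}{\|f\|_{L^2([0,\pi])}}.$$
   Context: Here $\langle f,\sin(nx)\rangle=\int_0^\pi f(x)\sin(nx)\,dx$, and $\nabla f=f'$ is the (weak) derivative of $f$. Roots are counted without multiplicity, i.e. the number of roots is the number of distinct points of $(0,\pi)$ at which $f$ vanishes. The logarithm is the natural logarithm. *)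

(* Defs.v *)
From HB Require Import structures.
From mathcomp Require Import all_boot all_order all_algebra.
From mathcomp Require Import all_classical all_reals all_analysis.

Set Implicit Arguments.
Unset Strict Implicit.
Unset Printing Implicit Defensive.
Import Order.TTheory GRing.Theory Num.Theory.
Import numFieldNormedType.Exports.
Local Open Scope classical_set_scope.
Local Open Scope ring_scope.

(** [Lnorm] integrates over the whole line, so the function is first extended
    by zero outside [D]. *)
Definition L2norm_on (R : realType) (D : set R) (f : R -> R) : \bar R :=
  Lnorm lebesgue_measure 2%:E (EFin \o (f \_ D)).

Definition test_function (R : realType) (D : set R) (phi : R -> R) : Prop :=
  [/\ forall (n : nat) (x : R), derivable (derive1n n phi) x 1,
      compact (closure [set x | phi x != 0])
    & closure [set x | phi x != 0] `<=` D].

Definition is_weak_derivative (R : realType) (D : set R) (f g : R -> R) : Prop :=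
  [/\ locally_integrable D f, locally_integrable D g
    & forall phi : R -> R, test_function D phi ->
        \int[lebesgue_measure]_(x in D) (f x * derive1 phi x) =
        - \int[lebesgue_measure]_(x in D) (g x * phi x)].

Definition sine_coef (R : realType) (f : R -> R) (n : nat) : R :=
  \int[lebesgue_measure]_(x in `[0, pi]) (f x * sin (n%:R * x)).

(* Main.v *)
Require Import Defs.
From mathcomp Require Import all_boot all_order all_algebra.
From mathcomp Require Import all_classical all_reals all_analysis.
From mathcomp Require Import ring lra.

(** Write A for the L2 norm of the weak derivative, nu for that of f, M for the
    maximum of |f| on [0, pi], and a_k for the sine coefficients of f. Three facts
    about f carry the whole argument.

    First, the derivative enters only through the Hoelder estimate
    |f b - f a| <= A sqrt (b - a) ([hoelder_half]). It follows from testing the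
    weak derivative against a smooth function that climbs from 0 to 1 just after
    a and descends just after b: pairing f with the derivative of this plateau
    nearly gives f a - f b, while the pairing with Df is controlled by A and the
    length of the plateau. Since nu <= sqrt pi M, the estimate shows that,
    up to a sign, f >= M / 2 on an interval of length r of order (nu / A)^2.

    Second, if d is large compared with 1 / r, the sign changes are irrelevant:
    the difference of two Fejer kernels centred at x0 and at - x0 is a sine
    polynomial of degree at most d that concentrates on that interval, and its
    pairing with f bounds the sum of the |a_k| from below by a multiple of M r
    ([sine_coef_sum_ge_of_peak]). A degree of order 1 / r suffices because the tail
    of the kernel decays like the inverse square of the distance.

    Third, if d is at most of order 1 / r, the Sturm-Hurwitz argument applies
    ([sturm_hurwitz_ge]). Choose among the zeros y of f those where f changes sign;
    then sin x times the product of the factors 2 cos x - 2 cos y has the sign of f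
    everywhere on (0, pi), and it is a combination of the first d sines with
    coefficients of total size at most 4^(d-1). Among d consecutive intervals
    of length r / d one contains no zero, and in its middle third every factor is at least
    of order (r / d)^2. This gives a lower bound of the shape M (c0 r / d)^(2d),
    where d <= c1 / r and 1 / r is of order (A / nu)^2, that is
    exp (- C (A / nu)^2 log (A / nu)) up to constants.

    With kappa = c A / nu, the bound to be proved is
    exp (- kappa^2 log^2 kappa) nu, which never exceeds nu.
    For c large it is far below the two bounds just described as soon as A / nu is
    bounded away from 0. When A / nu is small, f is nearly constant and the first
    coefficient alone suffices: the sine has integral 2, and 2 > sqrt pi
    ([sine_coef1_ge], [sine_coef_sum_ge_of_hoelder]). *)

Set Implicit Arguments.
Unset Strict Implicit.
Unset Printing Implicit Defensive.
Import Order.TTheory GRing.Theory Num.Theory.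
Import numFieldNormedType.Exports.
Local Open Scope classical_set_scope.
Local Open Scope ring_scope.

(** * Integrals of continuous functions over an interval *)

Section integrals.
Context {R : realType}.
Implicit Types (f g : R -> R) (a b : R).
Local Notation mu := lebesgue_measure.

Lemma within_continuousD (A : set R) f g : {within A, continuous f} ->
  {within A, continuous g} -> {within A, continuous (fun x => f x + g x)}.
Proof. by move=> cf cg x; apply: cvgD; [exact: cf|exact: cg]. Qed.

Lemma within_continuousM (A : set R) f g : {within A, continuous f} ->
  {within A, continuous g} -> {within A, continuous (fun x => f x * g x)}.
Proof. by move=> cf cg x; apply: cvgM; [exact: cf|exact: cg]. Qed.

Lemma integrable_within a b f : {within `[a, b], continuous f} ->
  mu.-integrable `[a, b] (EFin \o f).
Proof. by move=> cf; apply: continuous_compact_integrable => //; exact: segment_compact. Qed.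

(** Serves both test functions below: the Fejer peak and the sine product are
    visibly large only on a short interval. *)
Lemma Rintegral_ge_subitv a b p q v f : a <= p -> p <= q -> q <= b ->
  {within `[a, b], continuous f} -> {in `[a, b], forall x, 0 <= f x} ->
  {in `[p, q], forall x, v <= f x} ->
  v * (q - p) <= \int[mu]_(x in `[a, b]) f x.
Proof.
move=> ap pq qb cf f0 fv.
have sub : `[p, q] `<=` `[a, b].
  by move=> x /=; rewrite !in_itv/= => /andP[px xq]; apply/andP; split; lra.
have icf := integrable_within cf.
have -> : v * (q - p) = \int[mu]_(x in `[p, q]) v.
  rewrite Rintegral_cst//=.
  by rewrite lebesgue_measure_itv/= lte_fin; case: ltP => //= qp; congr (_ * _); lra.
have cf' : {within `[p, q], continuous f} by exact: continuous_subspaceW cf.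
apply: (@le_trans _ _ (\int[mu]_(x in `[p, q]) f x)).
  apply: le_Rintegral => //.
  - by apply: integrable_within; apply: continuous_subspaceT => x; exact: cvg_cst.
  - exact: integrable_within.
rewrite /Rintegral fine_le//.
- by apply: integrable_fin_num => //; exact: integrable_within.
- by apply: integrable_fin_num => //.
apply: ge0_subset_integral => //; first by case/integrableP: icf.
Qed.

Lemma Rintegral_const a b v : a <= b -> \int[mu]_(x in `[a, b]) v = v * (b - a).
Proof.
move=> ab; rewrite Rintegral_cst//= lebesgue_measure_itv/= lte_fin.
by case: ltP => //= qp; congr (_ * _); lra.
Qed.

Lemma Rintegral_derive1 (F f : R -> R) a b : a < b -> continuous f ->
  (forall x : R, is_derive x 1 F (f x)) -> \int[mu]_(x in `[a, b]) f x = F b - F a.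
Proof.
move=> ab cf dF; rewrite /Rintegral (@continuous_FTC2 _ f F)//.
- exact: continuous_subspaceT.
- have cF : continuous F.
    by move=> x; apply: differentiable_continuous; apply/derivable1_diffP; case: (dF x).
  split; [by move=> x _; case: (dF x)| exact/cvg_at_right_filter/cF | exact/cvg_at_left_filter/cF].
- by move=> x _; rewrite derive1E; case: (dF x).
Qed.

End integrals.

(** * Elementary trigonometric inequalities *)

Section trig.
Context {R : realType}.
Implicit Types x y u : R.

Lemma ge0_derive_nneg (F f : R -> R) x : F 0 = 0 -> (forall y : R, is_derive y 1 F (f y)) ->
  (forall y, 0 <= y -> 0 <= f y) -> 0 <= x -> 0 <= F x.
Proof.
move=> F0 dF f0; rewrite le_eqVlt => /predU1P[<-|x0]; first by rewrite F0.
rewrite -F0; apply: (@ger0_derive1_le_cc _ F 0 x) => //; rewrite ?in_itv/= ?lexx ?ltW//.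
- move=> z; rewrite in_itv/= => /andP[z0 _]; rewrite derive1E.
  by case: (dF z) => _ ->; exact/f0/ltW.
- apply: continuous_subspaceT => z; apply: differentiable_continuous.
  by apply/derivable1_diffP; case: (dF z).
Qed.

Lemma sin_lex x : 0 <= x -> sin x <= x.
Proof.
move=> x0; rewrite -subr_ge0; move: x0.
apply: (@ge0_derive_nneg (fun y => y - sin y) (fun y => 1 - cos y)); first by rewrite sin0 subr0.
by move=> y _; rewrite subr_ge0 cos_le1.
Qed.

Lemma cos_ge x : 1 - x ^+ 2 / 2 <= cos x.
Proof.
wlog x0 : x / 0 <= x.
  move=> h; have [/h//|x0] := leP 0 x.
  by rewrite -cosN -sqrrN; apply: h; lra.
have := @ge0_derive_nneg (fun y => cos y - (1 - y ^+ 2 / 2)) (fun y => y - sin y) x.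
rewrite cos0 -[_ <= cos x]subr_ge0; apply => //; first by lra.
  move=> y; apply: is_derive_eq; rewrite /GRing.scale/=; lra.
by move=> y y0; rewrite subr_ge0 sin_lex.
Qed.

Lemma sin_ge_cubic x : 0 <= x -> x - x ^+ 3 / 6 <= sin x.
Proof.
move=> x0; have := @ge0_derive_nneg (fun y => sin y - (y - y ^+ 3 / 6))
  (fun y => cos y - (1 - y ^+ 2 / 2)) x.
rewrite sin0 -[_ <= sin x]subr_ge0; apply => //; first by lra.
  move=> y; apply: is_derive_eq; rewrite /GRing.scale/=; lra.
by move=> y y0; rewrite subr_ge0 cos_ge.
Qed.

Lemma pi_lt4 : (pi : R) < 4.
Proof. by have := @pihalf_lt2 R; lra. Qed.

(** On [0, 2] the cubic bound gives x / 3, because x^2 <= 4 there; the rest of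
    [0, pi] is covered by the symmetry about pi / 2, as pi < 4. *)
Lemma sin_ge_third (d x : R) : 0 <= d -> d <= x -> x <= pi - d -> d / 3 <= sin x.
Proof.
have aux y : 0 <= y -> y <= 2 -> y / 3 <= sin y.
  move=> y0 y2; apply: le_trans (sin_ge_cubic y0).
  rewrite -subr_ge0 (_ : _ - _ = y * (4 - y ^+ 2) / 6); last by field.
  by rewrite divr_ge0// mulr_ge0//; nra.
move=> d0 dx xd; have := pi_lt4; have [x2|x2] := leP x 2 => p4.
  by apply: le_trans (aux _ _ x2); lra.
have -> : sin x = sin (pi - x) by rewrite sinB sinpi cospi; lra.
by apply: le_trans (aux _ _ _); lra.
Qed.

Lemma one_sub_cos_ge u : `|u| <= pi -> u ^+ 2 / 18 <= 1 - cos u.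
Proof.
wlog u0 : u / 0 <= u.
  move=> h; have [/h//|u0] := leP 0 u.
  by rewrite -cosN -sqrrN -normrN; apply: h; lra.
rewrite ger0_norm// => up.
have -> : cos u = cos (u / 2 *+ 2) by congr cos; rewrite mulr2n; lra.
rewrite cos_mulr2n cos2sin2.
have := @sin_ge_third (u / 2) (u / 2).
set s := sin _; move=> h; have : u / 2 / 3 <= s by apply: h; lra.
move=> us; have : (u / 6) ^+ 2 <= s ^+ 2 by apply: lerXn2r; rewrite ?nnegrE; lra.
by rewrite !mulr2n !expr2; lra.
Qed.

End trig.

(** * The Fejer kernel *)

Section fejer.
Context {R : realType}.
Implicit Types (x u : R) (n : nat).

(** The Fejer kernel up to the factor n: it is the squared modulus of the
    geometric sum of the e^(iju). Keeping the two squares avoids dividing by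
    sin (u / 2), which vanishes at the peak. *)
Definition fejer n u : R :=
  (\sum_(j < n) cos (j%:R * u)) ^+ 2 + (\sum_(j < n) sin (j%:R * u)) ^+ 2.

Lemma fejer_ge0 n u : 0 <= fejer n u.
Proof. by rewrite addr_ge0// sqr_ge0. Qed.

Lemma fejer_periodic n u : fejer n (u - pi *+ 2) = fejer n u.
Proof.
have per (j : nat) : j%:R * (u - pi *+ 2) + pi *+ 2 *+ j = j%:R * u.
  by rewrite mulrBr mulr_natl -(mulr_natl (pi *+ 2)) subrK.
congr (_ ^+ 2 + _ ^+ 2); apply: eq_bigr => j _.
  by rewrite -[in RHS]per; apply/esym/(periodicn (@cosD2pi R)).
by rewrite -[in RHS]per; apply/esym/(periodicn (@sinD2pi R)).
Qed.

(** The geometric sum times e^(iu) - 1 telescopes to e^(inu) - 1, of squared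
    modulus at most 4, and |e^(iu) - 1|^2 = 2 (1 - cos u). *)
Lemma fejer_tail n u : (1 - cos u) * fejer n u <= 2.
Proof.
have [] : (cos u - 1) * (\sum_(j < n) cos (j%:R * u)) -
    sin u * (\sum_(j < n) sin (j%:R * u)) = cos (n%:R * u) - 1 /\
    sin u * (\sum_(j < n) cos (j%:R * u)) +
    (cos u - 1) * (\sum_(j < n) sin (j%:R * u)) = sin (n%:R * u).
  elim: n => [|n [IH1 IH2]].
    by rewrite !big_ord0 mul0r cos0 sin0; split; ring.
  have c1 : cos (n%:R * u) = (cos (n%:R * u) - 1) + 1 by ring.
  have nE : n.+1%:R * u = n%:R * u + u by rewrite -natr1 mulrDl mul1r.
  rewrite !big_ord_recr/= nE cosD sinD; split.
    by rewrite !mulrDr; lra.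
  by rewrite !mulrDr; lra.
rewrite /fejer; set C := \sum_(j < n) cos _; set S := \sum_(j < n) sin _.
have := cos2Dsin2 u; have := cos2Dsin2 (n%:R * u); have := cos_geN1 (n%:R * u).
move=> + + + e1 e2; rewrite -e2.
have -> : cos (n%:R * u) = 1 + ((cos u - 1) * C - sin u * S) by rewrite e1; ring.
move: (cos u) (sin u) => c s; rewrite !expr2 => h1 h2 h3.
have : ((c - 1) * C - s * S) * ((c - 1) * C - s * S) +
    (s * C + (c - 1) * S) * (s * C + (c - 1) * S) - (2 - 2 * c) * (C * C + S * S) =
    (c * c + s * s - 1) * (C * C + S * S) by ring.
rewrite h3 subrr mul0r.
by lra.
Qed.

Lemma fejer_le n u : u != 0 -> `|u| <= pi -> fejer n u <= 36 / u ^+ 2.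
Proof.
move=> u0 upi; have u2 : 0 < u ^+ 2 by rewrite exprn_even_gt0.
rewrite ler_pdivlMr//; have := fejer_tail n u.
have := one_sub_cos_ge upi; have := fejer_ge0 n u.
by nra.
Qed.

(** In this range all the phases ju lie in [-1, 1], where the cosine is at
    least 1/2, so the terms of the cosine sum do not cancel. *)
Lemma fejer_peak n u : n%:R * `|u| <= 1 -> n%:R ^+ 2 / 4 <= fejer n u.
Proof.
move=> nu; have : n%:R / 2 <= \sum_(j < n) cos (j%:R * u).
  have -> : n%:R / 2 = \sum_(j < n) (2^-1 : R).
    by rewrite big_const_ord iter_addr addr0 -[RHS]mulr_natl.
  apply: ler_sum => j _; apply: le_trans (cos_ge _).
  have : `|j%:R * u| <= 1.
    rewrite normrM normr_nat; apply: le_trans nu.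
    by rewrite ler_wpM2r// ler_nat ltnW.
  rewrite ler_norml => /andP[? ?]; nra.
rewrite /fejer; set C := \sum_(j < n) cos _; set S := \sum_(j < n) sin _ => h.
have := ler0n R n; have := sqr_ge0 S; rewrite !expr2; nra.
Qed.

(** Subtracting the mirror image of the kernel turns it into a sine polynomial
    of degree less than n, whose pairing with f only sees the first n - 1
    sine coefficients. *)
Lemma fejer_subE n x0 x : fejer n (x - x0) - fejer n (x + x0) =
  \sum_(i < n) \sum_(j < n) 2 * sin ((i%:R - j%:R) * x0) * sin ((i%:R - j%:R) * x).
Proof.
have E u : fejer n u = \sum_(i < n) \sum_(j < n) cos ((i%:R - j%:R) * u).
  rewrite /fejer !expr2 !big_distrlr/= -big_split/=; apply: eq_bigr => i _.
  by rewrite -big_split/=; apply: eq_bigr => j _; rewrite mulrBl cosB.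
rewrite !E -sumrB; apply: eq_bigr => i _; rewrite -sumrB; apply: eq_bigr => j _.
by rewrite mulrBr mulrDr cosB cosD; ring.
Qed.

End fejer.

(** * Detecting a large value by a Fejer peak *)

Section peak.
Context {R : realType}.
Implicit Types (x u p r M a z : R) (f : R -> R) (n : nat).
Local Notation mu := lebesgue_measure.

Lemma within_continuous_sum (A : set R) n (h : nat -> R -> R) :
  (forall i, (i < n)%N -> {within A, continuous (h i)}) ->
  {within A, continuous (fun x => \sum_(i < n) h i x)}.
Proof.
elim: n => [_|n IH ch].
  by under eq_fun do rewrite big_ord0; apply: continuous_subspaceT => x; exact: cvg_cst.
under eq_fun do rewrite big_ord_recr/=.
by apply: within_continuousD; [apply: IH => i ni; apply: ch; rewrite ltnS ltnW|exact: ch].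
Qed.

Lemma norm_Rintegral_sum (a b : R) n (h : nat -> R -> R) (c : R) :
  (forall i, (i < n)%N -> {within `[a, b], continuous (h i)}) ->
  (forall i, (i < n)%N -> `|\int[mu]_(x in `[a, b]) h i x| <= c) ->
  `|\int[mu]_(x in `[a, b]) \sum_(i < n) h i x| <= n%:R * c.
Proof.
elim: n => [_ _|n IH ch hc].
  under eq_Rintegral do rewrite big_ord0.
  by rewrite Rintegral_cst//= mul0r normr0 mul0r.
under eq_Rintegral do rewrite big_ord_recr/=.
rewrite RintegralD//; last 2 first.
- apply: integrable_within; apply: within_continuous_sum => i ni.
  by apply: ch; rewrite ltnS ltnW.
- exact/integrable_within/ch.
apply: le_trans (ler_normD _ _) _.
rewrite -natr1 mulrDl mul1r lerD ?hc// IH// => i ni; [apply: ch|apply: hc];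
  by rewrite ltnS ltnW.
Qed.

Lemma term_le_sum_nat (F : nat -> R) (m n j : nat) : (forall k, 0 <= F k) ->
  (m <= j < n)%N -> F j <= \sum_(m <= k < n) F k.
Proof.
move=> F0 mjn; rewrite (bigD1_seq j)/=; [|by rewrite mem_index_iota|exact: iota_uniq].
by rewrite lerDl sumr_ge0.
Qed.

(** A smooth majorant of the tail of the Fejer kernel beyond distance 1 / a from
    the peak, whose primitive is an arctangent; its integral over the line is of order a. *)
Definition lorentz a u : R := 72 * a ^+ 2 / (1 + (a * u) ^+ 2).

Lemma lorentz_ge0 a u : 0 <= lorentz a u.
Proof. by apply: divr_ge0; [apply: mulr_ge0|apply: addr_ge0]; rewrite ?sqr_ge0. Qed.

Lemma continuous_lorentz a z : continuous (fun x => lorentz a (x - z)).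
Proof.
move=> x; apply: cvgM; first exact: cvg_cst.
apply: cvgV; first by rewrite gt_eqF// ltr_pwDl// sqr_ge0.
apply: cvgD; first exact: cvg_cst.
have h : a * (y - z) @[y --> x] --> a * (x - z).
  by apply: cvgM; [exact: cvg_cst|apply: cvgB; [exact: cvg_id|exact: cvg_cst]].
by under eq_cvg do rewrite expr2; rewrite expr2; apply: cvgM.
Qed.

Lemma Rintegral_lorentz_le a z : 0 < a ->
  \int[mu]_(x in `[0, pi]) lorentz a (x - z) <= 288 * a.
Proof.
move=> a0; pose F x := 72 * a * atan (a * (x - z)).
have dF x : is_derive x (1 : R) F (lorentz a (x - z)).
  rewrite /lorentz /F.
  have h : is_derive x (1 : R) (fun x => a * (x - z)) a.
    by apply: is_derive_eq; rewrite /GRing.scale/=; ring.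
  have h2 := @is_derive1_comp _ (@atan R) _ x _ _ (is_derive1_atan _) h.
  by apply: is_derive_eq; rewrite /GRing.scale/= !expr2; ring.
rewrite (Rintegral_derive1 (pi_gt0 R) (@continuous_lorentz a z) dF) /F.
have := @atan_ltpi2 R (a * (pi - z)); have := @atan_gtNpi2 R (a * (0 - z)).
have := @pi_lt4 R => p4 h1 h2; rewrite -mulrBr.
suff : atan (a * (pi - z)) - atan (a * (0 - z)) <= 4 by nra.
lra.
Qed.

Lemma fejer_le_lorentz n a u : 0 < a -> 1 <= a * `|u| -> `|u| <= pi ->
  fejer n u <= lorentz a u.
Proof.
move=> a0 au upi.
have u0 : u != 0 by apply/eqP => u0; move: au; rewrite u0 normr0 mulr0; lra.
apply: le_trans (fejer_le n u0 upi) _.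
have u2 : 0 < u ^+ 2 by rewrite exprn_even_gt0.
have : 1 <= (a * u) ^+ 2.
  by rewrite -real_normK ?num_real// normrM (gtr0_norm a0) exprn_ege1.
rewrite exprMn /lorentz exprMn => h.
rewrite ler_pdivrMr// mulrAC ler_pdivlMr; nra.
Qed.

(** Up to sign only |i - j| matters, so that the double sum of [fejer_subE] involves
    no sine coefficient beyond its degree; the diagonal contributes 0. *)
Lemma norm_Rintegral_sine_sub f (i j : nat) (S : R) :
  (forall k, (1 <= k)%N -> (k <= maxn i j)%N -> `|sine_coef f k| <= S) -> 0 <= S ->
  {within `[0, pi], continuous f} ->
  `|\int[mu]_(x in `[0, pi]) (f x * sin ((i%:R - j%:R) * x))| <= S.
Proof.
move=> hS S0 cf; case: (ltngtP i j) => ij.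
- under eq_Rintegral do rewrite -opprB mulNr -natrB ?(ltnW ij)// sinN -mulrN1 mulrA.
  rewrite RintegralZr//.
    rewrite normrM normrN1 mulr1 hS ?subn_gt0//.
    by rewrite (leq_trans (leq_subr _ _))// leq_maxr.
  apply: integrable_within; apply: within_continuousM => //.
  apply: continuous_subspaceT => x.
  by apply: continuous_comp; [exact: mulrl_continuous|exact: continuous_sin].
- under eq_Rintegral do rewrite -natrB ?(ltnW ij)//.
  rewrite hS ?subn_gt0//.
  by rewrite (leq_trans (leq_subr _ _))// leq_maxl.
under eq_Rintegral do rewrite ij subrr mul0r sin0 mulr0.
by rewrite Rintegral_cst//= mul0r normr0.
Qed.

(** Adding M times the three majorants makes the product of f with the peak
    nonnegative everywhere, so that the central part of the peak can be isolated
    without splitting the integral. The majorants sit at x0, at the mirror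
    point - x0, and at its translate by the period, 2 pi - x0: the last two
    cover the mirror kernel, whose argument x + x0 ranges over (0, 2 pi). Here y
    stands for the value of f at x. *)
Lemma fejer_pointwise n p r a x0 M x y : 0 < M -> 0 < r -> 0 <= p -> p + r <= pi ->
  a * r = 2 -> 0 < a -> x0 = p + r / 2 -> 0 <= x -> x <= pi -> `|y| <= M ->
  (p <= x -> x <= p + r -> M / 2 <= y) ->
  let g := y * (fejer n (x - x0) - fejer n (x + x0)) + M * (lorentz a (x - x0) +
     (lorentz a (x - - x0) + lorentz a (x - (pi *+ 2 - x0)))) in
  0 <= g /\ (`|x - x0| <= r / 2 -> M / 2 * fejer n (x - x0) <= g).
Proof.
move=> M0 r0 p0 prpi ar a0 x0E xge0 xpi yM yM2 /=.
have K2 : fejer n (x + x0) <= lorentz a (x - - x0) + lorentz a (x - (pi *+ 2 - x0)).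
  have x0r : r / 2 <= x0 by rewrite x0E; lra.
  have x0pi : x0 <= pi - r / 2 by rewrite x0E; lra.
  have [xx0|xx0] := leP (x + x0) pi.
    rewrite opprK; apply: le_trans (fejer_le_lorentz _ a0 _ _) _.
    - by rewrite ger0_norm; nra.
    - by rewrite ger0_norm; lra.
    - by rewrite lerDl lorentz_ge0.
  have p2 : (pi : R) *+ 2 = pi + pi by rewrite mulr2n.
  rewrite -fejer_periodic opprB addrA p2; apply: le_trans (fejer_le_lorentz _ a0 _ _) _.
  - by rewrite ler0_norm; nra.
  - by rewrite ler0_norm; lra.
  - by rewrite lerDr lorentz_ge0.
move: yM; rewrite ler_norml => /andP[f1 f2].
have := lorentz_ge0 a (x - x0); have := fejer_ge0 n (x - x0); have := fejer_ge0 n (x + x0).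
have far : r / 2 < `|x - x0| -> fejer n (x - x0) <= lorentz a (x - x0).
  move=> xx0; apply: fejer_le_lorentz => //; first by nra.
  by rewrite ler_norml x0E; apply/andP; split; lra.
have near : `|x - x0| <= r / 2 -> M / 2 <= y.
  by rewrite ler_norml x0E => /andP[? ?]; apply: yM2; lra.
move: K2 far near.
set c2 := lorentz _ _ + lorentz _ _; set k1 := fejer _ (x - _); set k2 := fejer _ _.
set c1 := lorentz _ _; move: c1 c2 k1 k2 => c1 c2 k1 k2 hk far near k20 k10 c10.
have [/near f3|/far kc] := leP `|x - x0| (r / 2).
  have e1 : 0 <= (y - M / 2) * k1 by rewrite mulr_ge0//; lra.
  have e2 : 0 <= (M - y) * k2 by rewrite mulr_ge0//; lra.
  have e3 : 0 <= M * (c2 - k2) by rewrite mulr_ge0//; lra.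
  have e4 : 0 <= M * c1 by rewrite mulr_ge0//; lra.
  have e5 : 0 <= M / 2 * k1 by rewrite mulr_ge0//; lra.
  by split=> [|_]; lra.
split=> //.
have e1 : 0 <= (M + y) * k1 by rewrite mulr_ge0//; lra.
have e2 : 0 <= (M - y) * k2 by rewrite mulr_ge0//; lra.
have e3 : 0 <= M * (c2 - k2) by rewrite mulr_ge0//; lra.
have e4 : 0 <= M * (c1 - k1) by rewrite mulr_ge0//; lra.
by lra.
Qed.

(** The peak of height n^2 / 4 and width 2 / n contributes at least M n / 4,
    the tails cost at most 1728 M / r <= M n / 8, and bounding each of the n^2
    terms of the test polynomial separately loses a factor n that is harmless
    in the application. *)
Lemma sine_coef_sum_ge_of_peak f n p r M : (0 < n)%N -> 0 < M -> 0 < r ->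
  {within `[0, pi], continuous f} -> {in `[0, pi], forall x, `|f x| <= M} ->
  0 <= p -> p + r <= pi -> {in `[p, p + r], forall x, M / 2 <= f x} ->
  13824 <= n%:R * r ->
  M / (16 * n%:R) <= \sum_(1 <= k < n) `|sine_coef f k|.
Proof.
move=> n0 M0 r0 cf fM p0 prpi fM2 nr.
have [S SE] : exists S, S = \sum_(1 <= k < n) `|sine_coef f k| by eexists.
rewrite -SE.
have n0' : 0 < n%:R :> R by rewrite ltr0n.
pose a := 2 / r; have a0 : 0 < a by rewrite divr_gt0.
have ar : a * r = 2 by rewrite /a divfK// gt_eqF.
have [x0 x0E] : exists x0, x0 = p + r / 2 by exists (p + r / 2).
pose T x := fejer n (x - x0) - fejer n (x + x0).
pose W x := lorentz a (x - x0) + (lorentz a (x - - x0) + lorentz a (x - (pi *+ 2 - x0))).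
have cW : {within `[0, pi], continuous W}.
  by apply: continuous_subspaceT => x; do ![apply: cvgD]; exact: continuous_lorentz.
pose h i j x := f x * (2 * sin ((i%:R - j%:R) * x0) * sin ((i%:R - j%:R) * x)).
have csin b : {within `[0, pi], continuous (fun x : R => sin (b * x))}.
  by apply: continuous_subspaceT => x; apply: continuous_comp;
    [exact: mulrl_continuous|exact: continuous_sin].
have ch i j : {within `[0, pi], continuous (h i j)}.
  apply: within_continuousM => //; apply: within_continuousM => //.
  by apply: continuous_subspaceT => x; exact: cvg_cst.
have fTE : (fun x => f x * T x) = (fun x => \sum_(i < n) \sum_(j < n) h i j x).
  apply/funext => x; rewrite /T fejer_subE mulr_sumr; apply: eq_bigr => i _.
  by rewrite mulr_sumr.
have cfT : {within `[0, pi], continuous (fun x => f x * T x)}.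
  rewrite fTE; apply: (@within_continuous_sum _ _ (fun i x => \sum_(j < n) h i j x)) => i _.
  exact: within_continuous_sum.
have IfT : \int[mu]_(x in `[0, pi]) (f x * T x) <= n%:R * (n%:R * (2 * S)).
  apply: le_trans (ler_norm _) _; rewrite fTE.
  apply: (@norm_Rintegral_sum _ _ _ (fun i x => \sum_(j < n) h i j x)) => i ni.
    exact: within_continuous_sum.
  apply: norm_Rintegral_sum => // j nj.
  rewrite /h; under eq_Rintegral do rewrite mulrCA.
  rewrite RintegralZl//; last exact/integrable_within/within_continuousM.
  rewrite normrM; apply: ler_pM => //.
    by rewrite normrM normr_nat ler_piMr// sin_max.
  apply: norm_Rintegral_sine_sub => //; last by rewrite SE sumr_ge0.
  move=> k k1 kij; rewrite SE; apply: (@term_le_sum_nat (fun k => `|sine_coef f k|) 1 n k) => //.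
  by rewrite k1 (leq_ltn_trans kij)// gtn_max ni.
have IW : \int[mu]_(x in `[0, pi]) W x <= 864 * a.
  have ic z : mu.-integrable `[0, pi] (EFin \o (fun x => lorentz a (x - z))).
    by apply: integrable_within; apply: continuous_subspaceT; exact: continuous_lorentz.
  have ic2 : mu.-integrable `[0, pi]
      (EFin \o (fun x => lorentz a (x - - x0) + lorentz a (x - (pi *+ 2 - x0)))).
    apply: integrable_within; apply: within_continuousD;
      apply: continuous_subspaceT; exact: continuous_lorentz.
  rewrite /W RintegralD//= RintegralD//.
  have -> : 864 * a = 288 * a + (288 * a + 288 * a) by ring.
  by rewrite !lerD// Rintegral_lorentz_le.
pose g x := f x * T x + M * W x.
have cMW : {within `[0, pi], continuous (fun x => M * W x)}.
  by apply: within_continuousM => //; apply: continuous_subspaceT => x; exact: cvg_cst.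
have Ig : \int[mu]_(x in `[0, pi]) g x <= n%:R * (n%:R * (2 * S)) + M * (864 * a).
  rewrite /g RintegralD//; try exact: integrable_within.
  rewrite RintegralZl//; last exact: integrable_within.
  by rewrite lerD// ler_wpM2l// ltW.
have g_ge x : 0 <= x -> x <= pi ->
    0 <= g x /\ (`|x - x0| <= r / 2 -> M / 2 * fejer n (x - x0) <= g x).
  move=> xge0 xpi; apply: (@fejer_pointwise n p r a x0 M x (f x)) => //.
    by apply: fM; rewrite in_itv/= xge0.
  by move=> xp xr; apply: fM2; rewrite in_itv/= xp.
have nV : n%:R * n%:R^-1 = 1 :> R by rewrite divff// gt_eqF.
have nV0 : 0 < n%:R^-1 :> R by rewrite invr_gt0.
have nVr : n%:R^-1 <= r / 2.
  by rewrite -(ler_pM2l n0') nV; clear -nr r0; lra.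
have [hp hq] : 0 <= x0 - n%:R^-1 /\ x0 + n%:R^-1 <= pi by clear -nVr x0E p0 prpi; split; lra.

have Ig2 : M / 2 * (n%:R ^+ 2 / 4) * (x0 + n%:R^-1 - (x0 - n%:R^-1)) <=
    \int[mu]_(x in `[0, pi]) g x.
  apply: Rintegral_ge_subitv => //.
  - by clear -nV0; lra.
  - exact: within_continuousD.
  - by move=> x; rewrite in_itv/= => /andP[? ?]; apply: (proj1 (g_ge x _ _)).
  move=> x; rewrite in_itv/= => /andP[x1 x2].
  have [xge0 xpi] : 0 <= x /\ x <= pi by clear -x1 x2 hp hq; split; lra.
  have xx0 : `|x - x0| <= n%:R^-1.
    by rewrite ler_norml; clear -x1 x2; apply/andP; split; lra.
  apply: le_trans (proj2 (g_ge x xge0 xpi) (le_trans xx0 nVr)).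
  rewrite ler_wpM2l//; first by clear -M0; lra.
  apply: fejer_peak.
  by apply: (@le_trans _ _ (n%:R * n%:R^-1)); [rewrite ler_wpM2l// ltW|rewrite nV].
have {Ig2} := le_trans Ig2 Ig.
have -> : M / 2 * (n%:R ^+ 2 / 4) * (x0 + n%:R^-1 - (x0 - n%:R^-1)) =
    M * n%:R / 4 * (n%:R / n%:R) by field; rewrite gt_eqF.
rewrite nV mulr1 => h1; rewrite ler_pdivrMr; last by rewrite mulr_gt0.
have h2 : 864 * a <= n%:R / 8.
  by clear -ar nr a0 r0; nra.
clear -h1 h2 M0 n0'; move: n%:R n0' h1 h2 => N N0 h1 h2.
have h3 : M * (864 * a) <= M * (N / 8) by rewrite ler_wpM2l// ltW.
rewrite -(ler_pM2l N0); lra.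
Qed.

End peak.

(** * Few sign changes: the Sturm-Hurwitz argument *)

Section sturm_hurwitz.
Context {R : realType}.
Implicit Types (x y u p r M a z l : R) (f : R -> R) (n k d : nat) (s : seq R).
Local Notation mu := lebesgue_measure.

(** For k = 1, and s made of distinct points of (0, pi), this is a sine polynomial
    that changes sign on (0, pi) exactly at these points; general k makes the expansion in sines inductive. *)
Definition sine_product k s x : R := sin (k%:R * x) * \prod_(y <- s) (2 * cos x - 2 * cos y).

Lemma continuous_sine_product k s : continuous (sine_product k s).
Proof.
elim: s => [|y s IH] x; rewrite /sine_product.
  under eq_fun do rewrite big_nil mulr1.
  by apply: continuous_comp; [exact: mulrl_continuous|exact: continuous_sin].
under eq_fun do rewrite big_cons mulrCA.
apply: (@cvgM _ _ _ _ (fun x => 2 * cos x - 2 * cos y) (sine_product k s)); last exact: IH.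
apply: cvgB; last exact: cvg_cst.
by apply: cvgM; [exact: cvg_cst|exact: continuous_cos].
Qed.

(** From 2 cos x sin (kx) = sin ((k+1)x) + sin ((k-1)x). *)
Lemma sine_product_cons k y s x : (0 < k)%N -> sine_product k (y :: s) x =
  sine_product k.+1 s x + sine_product k.-1 s x - 2 * cos y * sine_product k s x.
Proof.
case: k => // k _; rewrite /sine_product big_cons/=.
have -> : k.+2%:R * x = k.+1%:R * x + x by rewrite -[in LHS]natr1 mulrDl mul1r.
have -> : k%:R * x = k.+1%:R * x - x by rewrite -[in RHS]natr1 mulrDl mul1r addrK.
by rewrite sinD sinB; ring.
Qed.

(** Each factor 2 cos x - 2 cos y multiplies the sum of the absolute values of the
    sine coefficients of a sine polynomial by at most 4 and raises its degree by 1. *)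
Lemma norm_Rintegral_sine_product f d (S : R) k s : {within `[0, pi], continuous f} ->
  0 <= S -> (forall j, (0 < j <= d)%N -> `|sine_coef f j| <= S) -> (k + size s <= d)%N ->
  `|\int[mu]_(x in `[0, pi]) (f x * sine_product k s x)| <= 4 ^+ size s * S.
Proof.
move=> cf S0 fS; elim: s k => [|y s IH] [|k] ks.
- under eq_Rintegral do rewrite /sine_product mul0r sin0 mul0r mulr0.
  by rewrite Rintegral_cst//= mul0r normr0 mulr_ge0.
- under eq_Rintegral do rewrite /sine_product big_nil mulr1.
  by rewrite expr0 mul1r; apply: fS; rewrite /= in ks; rewrite -[k.+1]addn0.
- under eq_Rintegral do rewrite /sine_product mul0r sin0 mul0r mulr0.
  by rewrite Rintegral_cst//= mul0r normr0 mulr_ge0.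
have cs j : {within `[0, pi], continuous (fun x => f x * sine_product j s x)}.
  by apply: within_continuousM => //; exact/continuous_subspaceT/continuous_sine_product.
have int1 j := integrable_within (cs j).
have -> : \int[mu]_(x in `[0, pi]) (f x * sine_product k.+1 (y :: s) x) =
    \int[mu]_(x in `[0, pi]) (f x * sine_product k.+2 s x) +
    \int[mu]_(x in `[0, pi]) (f x * sine_product k s x) -
    2 * cos y * \int[mu]_(x in `[0, pi]) (f x * sine_product k.+1 s x).
  rewrite -RintegralZl// -RintegralD// -RintegralB//.
  - by apply: eq_Rintegral => x _; rewrite sine_product_cons//=; ring.
  - exact/integrable_within/within_continuousD.
  - apply/integrable_within/within_continuousM => //.
    by apply: continuous_subspaceT => x; exact: cvg_cst.
move: ks; rewrite /= addnS addSn => ks.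
have h1 : `|\int[mu]_(x in `[0, pi]) (f x * sine_product k.+2 s x)| <= 4 ^+ size s * S.
  by apply: IH; rewrite !addSn.
have h2 : `|\int[mu]_(x in `[0, pi]) (f x * sine_product k s x)| <= 4 ^+ size s * S.
  by apply: IH; rewrite ltnW// ltnW.
have h3 : `|2 * cos y * \int[mu]_(x in `[0, pi]) (f x * sine_product k.+1 s x)| <= 2 * (4 ^+ size s * S).
  rewrite normrM ler_pM//; last by apply: IH; rewrite addSn ltnW.
  by rewrite normrM normr_nat ler_piMr// cos_max.
rewrite exprS -[leRHS]mulrA.
apply: le_trans (ler_normB _ _) _; apply: le_trans (lerD (ler_normD _ _) (lexx _)) _.
lra.
Qed.

(** Of m + 1 adjacent open intervals of length l, one avoids m given points: if the
    leftmost one is hit, discard it together with the points to the left of its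
    right end, at least one in number. *)
Lemma exists_gap s m l a : (size s <= m)%N -> 0 <= l ->
  exists q, [/\ a <= q, q + l <= a + m.+1%:R * l &
    forall y, y \in s -> y <= q \/ q + l <= y].
Proof.
move=> + l0; elim: m s a => [|m IH] s a sm.
  move: sm; rewrite leqn0 size_eq0 => /eqP ->; exists a; split => //; lra.
have [/hasP[y ys /andP[ay yl]]|/hasPn no] := boolP (has (fun y => (a < y) && (y < a + l)) s).
  have [|q [aq ql qs]] := IH [seq z <- s | a + l <= z] (a + l) _.
    rewrite -ltnS (leq_trans _ sm)// size_filter -[ltnRHS](count_predC (fun z => a + l <= z)).
    by rewrite -[ltnLHS]addn0 ltn_add2l -has_count; apply/hasP; exists y => //=; rewrite -ltNge.
  exists q; split; first lra.
    by rewrite -natr1; lra.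
  move=> z zs; have [alz|zal] := leP (a + l) z; last by left; lra.
  by apply: qs; rewrite mem_filter alz.
exists a; split => //; first by rewrite -natr1 -[in leRHS]natr1; have := ler0n R m; nra.
move=> y /no; rewrite negb_and -!leNgt => /orP[]; [by left|by right].
Qed.

Lemma constant_sign f l b : l < b -> {within `[l, b], continuous f} ->
  (forall x, l < x -> x < b -> f x != 0) ->
  exists e : bool, forall x, l < x -> x < b -> 0 <= (-1) ^+ e * f x.
Proof.
move=> lb cf f0; pose c := (l + b) / 2.
have fc : f c != 0 by apply: f0; rewrite /c; lra.
exists (f c < 0) => x lx xb; rewrite leNgt; apply/negP => fx.
have ivt u v : u <= v -> l < u -> v < b -> Num.min (f u) (f v) <= 0 <= Num.max (f u) (f v) -> False.
  move=> uv lu vb h.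
  have [|z + fz] := IVT uv _ h.
    apply: continuous_subspaceW cf => z /=; rewrite !in_itv/= => /andP[? ?].
    by apply/andP; split; lra.
  rewrite in_itv/= => /andP[uz zv]; have lz : l < z by lra.
  have zb : z < b by lra.
  by have := f0 z lz zb; rewrite fz eqxx.
have lc : l < c by rewrite /c; lra.
have cb : c < b by rewrite /c; lra.
have prod : (f c <= 0 /\ 0 <= f x) \/ (0 <= f c /\ f x <= 0).
  by move: fx; have [fc0|fc0] := ltP (f c) 0; rewrite ?expr0 ?expr1 => fx; [left|right]; split; lra.
have [xc|cx] := leP x c.
  apply: (ivt x c) => //; rewrite ge_min le_max.
  by case: prod => -[-> ->]; rewrite ?orbT.
apply: (ivt c x) => //; first exact: ltW.
rewrite ge_min le_max.
by case: prod => -[-> ->]; rewrite ?orbT.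
Qed.

Lemma cos_lt x y : 0 <= x -> x < y -> y <= pi -> cos y < cos x.
Proof.
by move=> x0 xy yp; rewrite ltr_cos// in_itv/=; apply/andP; split; lra.
Qed.

(** Going from right to left, a zero is kept exactly when f has opposite signs
    on the two adjacent gaps. A factor 2 cos x - 2 cos y is positive to the
    left of y and negative to its right, because the cosine decreases on [0, pi]. *)
Lemma sign_pattern f s l : 0 <= l -> l < pi -> {within `[0, pi], continuous f} ->
  path <%R l s -> {in s, forall y, y < pi /\ f y = 0} ->
  (forall x, l < x -> x < pi -> f x = 0 -> x \in s) ->
  exists (s' : seq R) (e : bool), [/\ (size s' <= size s)%N, {subset s' <= s} &
    forall x, l < x -> x < pi ->
      0 <= (-1) ^+ e * f x * \prod_(y <- s') (2 * cos x - 2 * cos y)].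
Proof.
move=> + + cf; elim: s l => [|y s IH] l l0 lpi.
  move=> _ _ fs; have [||e fe] := @constant_sign f l pi lpi.
  - apply: continuous_subspaceW cf => z /=; rewrite !in_itv/= => /andP[? ?].
    by apply/andP; split; lra.
  - by move=> x lx xpi; apply/eqP => /fs; rewrite in_nil => /(_ lx xpi).
  by exists [::], e; split => // x lx xpi; rewrite big_nil mulr1 fe.
rewrite [path _ _ _]/= => /andP[ly ys] sf fs.
have [ypi fy] : y < pi /\ f y = 0 by apply: sf; rewrite mem_head.
have ysl z : z \in s -> y < z by move: ys; rewrite lt_path_sortedE => /andP[/allP + _]; apply.
have [|||s' [e [s's s's2 fe]]] := IH y _ ypi ys _ _.
- by lra.
- by move=> z zs; apply: sf; rewrite in_cons zs orbT.
- move=> x yx xpi fx; have := fs x; rewrite in_cons gt_eqF//= => h.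
  by apply: h => //; lra.
have [||e' fe'] := @constant_sign f l y ly.
- apply: continuous_subspaceW cf => z /=; rewrite !in_itv/= => /andP[? ?].
  by apply/andP; split; lra.
- move=> x lx xy; apply/eqP => fx; have := fs x lx; rewrite in_cons lt_eqF//= => h.
  by have /ysl : x \in s; [apply: h => //; lra|lra].
have pos x : l < x -> x < y -> 0 <= \prod_(y <- s') (2 * cos x - 2 * cos y).
  move=> lx xy; rewrite big_seq; apply: prodr_ge0 => z /s's2 zs.
  have [zpi _] : z < pi /\ f z = 0 by apply: sf; rewrite in_cons zs orbT.
  by have := ysl _ zs; move=> yz; have := @cos_lt x z; lra.
have sub : {subset s' <= y :: s} by move=> z /s's2 zs; rewrite in_cons zs orbT.
have [ee|ee] := eqVneq e e'.
  exists s', e; split=> //; first by rewrite ltnW.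
  move=> x lx xpi; case: (ltgtP x y) => [xy|yx|->]; last by rewrite fy mulr0 mul0r.
  - by rewrite mulr_ge0 ?pos// ee fe'.
  - exact: fe.
have eE : e' = ~~ e by case: (e) (e') ee => -[].
exists (y :: s'), e'; split=> //.
  by move=> z; rewrite !in_cons => /orP[->//|/s's2 ->]; rewrite orbT.
move=> x lx xpi; rewrite big_cons; case: (ltgtP x y) => [xy|yx|->]; last by rewrite fy mulr0 mul0r.
- apply: mulr_ge0; first exact: fe'.
  by apply: mulr_ge0; [have := @cos_lt x y; lra|exact: pos].
- have := fe x yx xpi; rewrite eE signrN.
  set P := \prod_(_ <- _) _ => h.
  have : 0 <= 2 * cos y - 2 * cos x by have := @cos_lt y x; lra.
  move=> h2; have := mulr_ge0 h h2; lra.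
Qed.

(** The difference factors as a product of the sines of the half sum and of the
    half difference; both half angles stay at distance at least d / 2 from multiples of pi. *)
Lemma dist_cos_ge (d x y : R) : 0 <= d -> d <= x -> x <= pi - d -> 0 <= y -> y <= pi ->
  d <= `|x - y| -> d ^+ 2 / 9 <= `|2 * cos x - 2 * cos y|.
Proof.
move=> d0 dx xd y0 ypi dxy.
have -> : 2 * cos x - 2 * cos y = - (4 * (sin ((x + y) / 2) * sin ((x - y) / 2))).
  have -> : cos x = cos ((x + y) / 2 + (x - y) / 2) by congr cos; lra.
  have -> : cos y = cos ((x + y) / 2 - (x - y) / 2) by congr cos; lra.
  by rewrite cosD cosB; ring.
have s1 : d / 2 / 3 <= sin ((x + y) / 2) by apply: sin_ge_third; lra.
have s2 : d / 2 / 3 <= `|sin ((x - y) / 2)|.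
  move: dxy; have [yx|xy] := leP y x => dxy.
    apply: le_trans (ler_norm _); apply: sin_ge_third; move: dxy; rewrite ?ger0_norm; lra.
  rewrite -normrN -sinN; apply: le_trans (ler_norm _).
  by apply: sin_ge_third; move: dxy; rewrite ?ltr0_norm; lra.
rewrite normrN !normrM (ger0_norm (ler0n _ _)) (@ger0_norm _ (sin ((x + y) / 2))); last lra.
by rewrite expr2; nra.
Qed.

Lemma expr_le_norm_prod (q : R) (F : R -> R) s : 0 <= q ->
  {in s, forall y, q <= `|F y|} -> q ^+ size s <= `|\prod_(y <- s) F y|.
Proof.
move=> q0; elim: s => [|y s IH] Fs; first by rewrite big_nil normr1.
rewrite big_cons normrM exprS ler_pM ?exprn_ge0//; first exact/Fs/mem_head.
by apply: IH => z zs; apply: Fs; rewrite in_cons zs orbT.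
Qed.

(** On the middle third of a zero-free interval, of length d, the test function
    is at least (d / 3) (d^2 / 9)^m, where m is the number of sign changes; the total size
    4^m of its sine coefficients turns d^2 / 9 into (d / 6)^2. *)
Lemma sturm_hurwitz_ge f s p r M : 0 < M -> 0 < r -> r <= 1 ->
  {within `[0, pi], continuous f} -> path <%R 0 s ->
  {in s, forall y, y < pi /\ f y = 0} ->
  (forall x, 0 < x -> x < pi -> f x = 0 -> x \in s) ->
  0 <= p -> p + r <= pi -> {in `[p, p + r], forall x, M <= `|f x|} ->
  12 * M * (r / (18 * (size s).+1%:R)) ^+ (2 * (size s).+1) <=
    \sum_(1 <= k < (size s).+2) `|sine_coef f k|.
Proof.
move=> M0 r0 r1 cf ps sf fs p0 prpi fM; set m := size s.
have [S SE] : exists S, S = \sum_(1 <= k < m.+2) `|sine_coef f k| by eexists.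
rewrite -SE.
have m0 : 0 < m.+1%:R :> R by rewrite ltr0n.
have m1 : 1 <= m.+1%:R :> R by rewrite ler1n.
have [d dE] : exists d : R, d = r / m.+1%:R / 3 by exists (r / m.+1%:R / 3).
have dm : d * m.+1%:R * 3 = r by rewrite dE; field; rewrite gt_eqF.
have d0 : 0 < d by rewrite dE !divr_gt0.
have d1 : d <= 1 by clear -dm m1 r1 d0; nra.
have -> : r / (18 * m.+1%:R) = d / 6 by rewrite dE; field; rewrite gt_eqF.
have [s' [e [s's s's2 fe]]] := sign_pattern (lexx 0) (pi_gt0 R) cf ps sf fs.
have d30 : 0 <= 3 * d by rewrite mulr_ge0// ltW.
have [q [pq ql qs]] := exists_gap p s's d30.
have ql3 : q + 3 * d <= p + r by clear -ql dm; lra.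
pose g x := (-1) ^+ e * (f x * sine_product 1 s' x).
have gE x : g x = (-1) ^+ e * f x * \prod_(y <- s') (2 * cos x - 2 * cos y) * sin x.
  by rewrite /g /sine_product mul1r; ring.
have cfs : {within `[0, pi], continuous (fun x => f x * sine_product 1 s' x)}.
  by apply: within_continuousM => //; exact/continuous_subspaceT/continuous_sine_product.
have cg : {within `[0, pi], continuous g}.
  by apply: within_continuousM => //; apply: continuous_subspaceT => x; exact: cvg_cst.
have g0 x : 0 <= x -> x <= pi -> 0 <= g x.
  rewrite le_eqVlt => /predU1P[<- _|x0]; first by rewrite gE sin0 mulr0.
  rewrite le_eqVlt => /predU1P[->|xpi]; first by rewrite gE sinpi mulr0.
  by rewrite gE mulr_ge0 ?fe// ltW// sin_gt0_pi// x0.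
have gl x : q + d <= x -> x <= q + 2 * d -> M * ((d ^+ 2 / 9) ^+ size s' * (d / 3)) <= g x.
  move=> x1 x2.
  have [xpi x0 x0' xpi'] : [/\ x <= pi - d, d <= x, 0 <= x & x <= pi].
    by clear -x1 x2 pq p0 ql3 prpi d0; split; lra.
  rewrite -[g x]ger0_norm; last exact: g0.
  rewrite gE !normrM normrX normrN1 expr1n mul1r -mulrA ler_pM//; first exact: ltW.
  - by rewrite mulr_ge0 ?exprn_ge0 ?divr_ge0 ?sqr_ge0 ?ltW.
  - by apply: fM; rewrite in_itv/=; clear -x1 x2 pq ql3 d0; apply/andP; split; lra.
  rewrite ler_pM ?exprn_ge0 ?divr_ge0 ?sqr_ge0 ?(ltW d0)//; last first.
    by apply: le_trans (ler_norm _); apply: sin_ge_third => //; exact: ltW.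
  apply: expr_le_norm_prod => [|y ys']; first by rewrite divr_ge0 ?sqr_ge0.
  have ys := s's2 _ ys'; have [ypi _] := sf _ ys.
  have y0 : 0 < y by move: ps; rewrite lt_path_sortedE => /andP[/allP/(_ _ ys)].
  apply: dist_cos_ge; rewrite ?(ltW d0) ?(ltW y0) ?(ltW ypi)//.
  have := qs _ ys'; clear -x1 x2; case=> yq; first by rewrite ger0_norm; lra.
  by rewrite ler0_norm; lra.
have Ig : \int[mu]_(x in `[0, pi]) g x <= 4 ^+ size s' * S.
  apply: le_trans (ler_norm _) _; rewrite RintegralZl//; last exact: integrable_within.
  rewrite normrM normrX normrN1 expr1n mul1r.
  apply: (@norm_Rintegral_sine_product _ m.+1) => //; first by rewrite SE sumr_ge0.
  by move=> j jm; rewrite SE; apply: (@term_le_sum_nat _ (fun k => `|sine_coef f k|) 1 m.+2 j).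
have Il : M * ((d ^+ 2 / 9) ^+ size s' * (d / 3)) * (q + 2 * d - (q + d)) <=
    \int[mu]_(x in `[0, pi]) g x.
  have [h1 h2 h3] : [/\ 0 <= q + d, q + d <= q + 2 * d & q + 2 * d <= pi].
    by clear -pq p0 d0 ql3 prpi; split; lra.
  apply: Rintegral_ge_subitv => //.
  - by move=> x; rewrite in_itv/= => /andP[? ?]; exact: g0.
  - by move=> x; rewrite in_itv/= => /andP[? ?]; exact: gl.
have := le_trans Il Ig; rewrite -/m.
have -> : d ^+ 2 / 9 = 4 * (d / 6) ^+ 2 by rewrite !expr2; field.
rewrite [(4 * _) ^+ _]exprMn.
have : (d / 6) ^+ (2 * m.+1) <= (d / 6) ^+ (2 * (size s').+1).
  by rewrite ler_wiXn2l ?leq_mul2l//; clear -d0 d1; lra.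
rewrite (mulnS 2 (size s')) exprD (exprM _ 2 (size s')).
have : 0 < 4 ^+ size s' :> R by rewrite exprn_gt0.
have : 0 <= ((d / 6) ^+ 2) ^+ size s' by rewrite exprn_ge0// sqr_ge0.
move: ((d / 6) ^+ 2 ^+ size s') (4 ^+ size s') (_ ^+ (2 * m.+1)) => P Q X.
clear -M0 d0 => P0 Q0 XP H.
have : Q * (12 * M * ((d / 6) ^+ 2 * P)) <= Q * S by apply: le_trans H; rewrite expr2; lra.
by rewrite ler_pM2l// => h; apply: le_trans h; rewrite ler_wpM2l//; lra.
Qed.

End sturm_hurwitz.

(** * Smooth step functions *)

Section smooth_step.
Context {R : realType}.
Implicit Types (x y : R) (f g : R -> R).

(** Smoothness in a form that proceeds by induction on the order: closure under
    products and inverses then needs no formula for the higher derivatives. *)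
Fixpoint differentiable_upto n f : Prop :=
  if n is n'.+1 then
    (forall x : R, derivable f x 1) /\ differentiable_upto n' (derive1 f)
  else True.

Lemma derivable_derive1n f : (forall n, differentiable_upto n f) ->
  forall n x, derivable (derive1n n f) x 1.
Proof.
move=> df n; elim: n f df => [f df|n IH f df] x; first by case: (df 1%N).
by rewrite derive1Sn; apply: IH => m; case: (df m.+1).
Qed.

Lemma differentiable_uptoS n f g : (forall x : R, is_derive x 1 f (g x)) ->
  differentiable_upto n g -> differentiable_upto n.+1 f.
Proof.
move=> fg dg; split; first by move=> x; case: (fg x).
suff -> : derive1 f = g by [].
by apply/funext => x; rewrite derive1E; case: (fg x).
Qed.

Lemma differentiable_uptoW n f : differentiable_upto n.+1 f -> differentiable_upto n f.
Proof.
elim: n f => // n IH f [df dn]; split => //; exact: IH.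
Qed.

Lemma is_derive_derive1 f x : derivable f x 1 -> is_derive x 1 f (derive1 f x).
Proof. by rewrite derive1E; exact: derivableP. Qed.

Lemma differentiable_upto_cst n (c : R) : differentiable_upto n (fun=> c).
Proof.
elim: n c => // n IH c; apply: (@differentiable_uptoS _ _ (fun=> 0)); last exact: IH.
Qed.

Lemma differentiable_uptoD n f g : differentiable_upto n f ->
  differentiable_upto n g -> differentiable_upto n (fun x => f x + g x).
Proof.
elim: n f g => // n IH f g [df df'] [dg dg'].
apply: (@differentiable_uptoS _ _ (fun x => derive1 f x + derive1 g x)); last exact: IH.
by move=> x; apply: is_deriveD; exact: is_derive_derive1.
Qed.

Lemma differentiable_uptoM n f g : differentiable_upto n f ->
  differentiable_upto n g -> differentiable_upto n (fun x => f x * g x).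
Proof.
elim: n f g => // n IH f g dF dG.
have [df df'] := dF; have [dg dg'] := dG.
apply: (@differentiable_uptoS _ _ (fun x => f x * derive1 g x + g x * derive1 f x)).
  by move=> x; apply: is_deriveM; exact: is_derive_derive1.
by apply: differentiable_uptoD; apply: IH => //; exact: differentiable_uptoW.
Qed.

Lemma differentiable_uptoV n f : (forall x, f x != 0) -> differentiable_upto n f ->
  differentiable_upto n (fun x => (f x)^-1).
Proof.
move=> f0; elim: n => // n IH dF; have [df df'] := dF.
apply: (@differentiable_uptoS _ _ (fun x => (f x)^-1 * (f x)^-1 * (-1 * derive1 f x))).
  move=> x; have dx := is_derive_derive1 (df x).
  have h := is_deriveV (f0 x) dx; apply: is_derive_eq.
  by rewrite /GRing.scale/= -exprVn expr2; ring.
have := IH (differentiable_uptoW dF) => dV.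
apply: differentiable_uptoM; first exact: differentiable_uptoM.
by apply: differentiable_uptoM => //; exact: differentiable_upto_cst.
Qed.

Lemma differentiable_upto_affine n f (a b : R) : differentiable_upto n f ->
  differentiable_upto n (fun x => f (a * x + b)).
Proof.
elim: n f => // n IH f [df df'].
apply: (@differentiable_uptoS _ _ (fun x => derive1 f (a * x + b) * a)).
  move=> x; have h : is_derive x (1 : R) (fun x => a * x + b) a.
    by apply: is_derive_eq; rewrite /GRing.scale/=; ring.
  exact: (@is_derive1_comp _ f _ x _ _ (is_derive_derive1 (df _)) h).
by apply: differentiable_uptoM; [exact: IH|exact: differentiable_upto_cst].
Qed.

(** The family x^-k e^(-1/x), extended by 0, is closed under differentiation up
    to linear combinations, which gives smoothness of all its members by a single
    induction. *)
Definition flat k x : R := if 0 < x then x^-1 ^+ k * expR (- x^-1) else 0.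

Lemma flat_ge0 k x : 0 <= flat k x.
Proof.
rewrite /flat; case: ifPn => // x0.
by rewrite mulr_ge0 ?exprn_ge0 ?invr_ge0 ?expR_ge0// ltW.
Qed.

(** From e^y >= y^(k+1) / (k+1)! at y = 1 / x. This linear bound is what
    makes the difference quotients at 0 converge to 0. *)
Lemma flat_le k x : 0 <= x -> flat k x <= (k.+1)`!%:R * x.
Proof.
move=> x0; rewrite /flat; case: ifPn => [{}x0|_]; last by rewrite mulr_ge0.
have y0 : 0 < x^-1 by rewrite invr_gt0.
have := expR_ge1Dxn k (ltW y0).
have f0 : 0 < (k.+1)`!%:R :> R by rewrite ltr0n fact_gt0.
rewrite expRN ler_pdivrMr ?expR_gt0// exprS => h.
have : x^-1 * x^-1 ^+ k / (k.+1)`!%:R <= expR x^-1 by lra.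
rewrite ler_pdivrMr// => h2.
have : x * (x^-1 * x^-1 ^+ k) <= x * (expR x^-1 * (k.+1)`!%:R) by rewrite ler_wpM2l// ltW.
by rewrite [x * (x^-1 * _)]mulrA divff ?gt_eqF// mul1r => /le_trans; apply; lra.
Qed.

(** At 0 the difference quotient of the member of index k is the member of index
    k + 1, so the limit follows from [flat_le]. *)
Lemma is_derive_flat k x :
  is_derive x (1 : R) (flat k) (flat k.+2 x - k%:R * flat k.+1 x).
Proof.
have [x0|x0|->] := ltgtP x 0.
- have -> : flat k.+2 x - k%:R * flat k.+1 x = 0.
    by rewrite /flat ltNge (ltW x0)/= mulr0 subr0.
  apply: (@near_eq_is_derive _ _ _ (cst 0)).
  near=> y; rewrite /flat ltNge ifF//; apply/negbTE/negPn/ltW.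
  by near: y; exact: lt_nbhsl.
- apply: (@near_eq_is_derive _ _ _ (fun y => y^-1 ^+ k * expR (- y^-1))).
    near=> y; rewrite /flat ifT//; near: y; exact: lt_nbhsr.
  have xn0 : x != 0 by rewrite gt_eqF.
  have dV : is_derive x (1 : R) (fun y : R => y^-1) (- x^-1 ^+ 2).
    have h := @is_deriveV _ id x 1 1 xn0 (is_derive_id _ _).
    by apply: is_derive_eq; rewrite /GRing.scale/= mulr1 exprVn.
  have dE : is_derive x (1 : R) (fun y : R => expR (- y^-1)) (x^-1 ^+ 2 * expR (- x^-1)).
    have h := @is_derive1_comp _ expR (fun y => - y^-1) x _ _ (is_derive_expR _) (is_deriveN dV).
    by apply: is_derive_eq; rewrite opprK mulrC.
  have dX : is_derive x (1 : R) (fun y : R => y^-1 ^+ k) (- (k%:R * x^-1 ^+ k.+1)).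
    have -> : (fun y : R => y^-1 ^+ k) = (fun y : R => y^-1) ^+ k.
      by apply/funext => y; rewrite exprfctE.
    have -> : - (k%:R * x^-1 ^+ k.+1) = (k%:R * x^-1 ^+ k.-1) *: (- x^-1 ^+ 2).
      rewrite /GRing.scale/= mulrN -mulrA -exprD; case: (k) => [|j]; first by rewrite !mul0r.
      by rewrite addn2.
    exact: is_deriveX.
  rewrite /flat x0; 
  have -> : x^-1 ^+ k.+2 * expR (- x^-1) - k%:R * (x^-1 ^+ k.+1 * expR (- x^-1)) =
    x^-1 ^+ k *: (x^-1 ^+ 2 * expR (- x^-1)) +
    expR (- x^-1) *: (- (k%:R * x^-1 ^+ k.+1)) by rewrite /GRing.scale/= !exprS; ring.
  exact: is_deriveM dX dE.
- rewrite /flat ltxx mulr0 subr0.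
  have lim : h^-1 *: ((flat k \o shift 0) (h *: (1 : R)) - flat k 0) @[h --> 0^'] --> (0 : R).
    apply/cvgrPdist_le => e e0; near=> h.
    have h0 : h != 0 by near: h; exact: nbhs_dnbhs_neq.
    rewrite sub0r normrN /= addr0 /GRing.scale/= mulr1 {2}/flat ltxx subr0.
    have -> : h^-1 * flat k h = flat k.+1 h.
      by rewrite /flat; case: ifP => _; rewrite ?mulr0// exprS mulrA.
    rewrite ger0_norm ?flat_ge0//; have [h1|h1] := leP h 0.
      by rewrite /flat ltNge h1/= ltW.
    apply: le_trans (flat_le _ (ltW h1)) _.
    rewrite mulrC -ler_pdivlMr ?ltr0n ?fact_gt0//.
    apply: le_trans (ler_norm _) _; near: h; apply: dnbhs0_le.
    by rewrite divr_gt0// ltr0n fact_gt0.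
  apply: DeriveDef; first by apply/cvg_ex; exists 0.
  exact: cvg_lim lim.
Unshelve. all: by end_near. Qed.

Lemma differentiable_upto_flat n k : differentiable_upto n (flat k).
Proof.
elim: n k => // n IH k.
apply: (@differentiable_uptoS _ _ (fun x => flat k.+2 x + - k%:R * flat k.+1 x)).
  by move=> x; rewrite mulNr; exact: is_derive_flat.
apply: differentiable_uptoD => //.
by apply: differentiable_uptoM => //; exact: differentiable_upto_cst.
Qed.

Lemma flat_homo : {homo flat 0 : x y / x <= y}.
Proof.
move=> x y xy; have [x0|x0] := leP x 0.
  by rewrite {1}/flat ltNge x0 flat_ge0.
rewrite /flat x0 (lt_le_trans x0 xy) !expr0 !mul1r ler_expR lerN2 lef_pV2//.
by rewrite posrE (lt_le_trans x0 xy).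
Qed.

Lemma exists_smooth_step : exists S : R -> R, [/\ forall n, differentiable_upto n S,
  forall x, x <= 0 -> S x = 0, forall x, 1 <= x -> S x = 1 &
  {homo S : x y / x <= y}].
Proof.
have flat0 x : x <= 0 -> flat 0 x = 0 by move=> x0; rewrite /flat ltNge x0.
have flat_gt0 x : 0 < x -> 0 < flat 0 x.
  by move=> x0; rewrite /flat x0 mul1r expR_gt0.
have den x : 0 < flat 0 x + flat 0 (-1 * x + 1).
  have [x0|x0] := leP x 0.
    by apply: ltr_wpDl; [exact: flat_ge0|apply: flat_gt0; lra].
  by apply: ltr_pwDl; [exact: flat_gt0|exact: flat_ge0].
exists (fun x => flat 0 x * (flat 0 x + flat 0 (-1 * x + 1))^-1); split.
- move=> n; apply: differentiable_uptoM; first exact: differentiable_upto_flat.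
  apply: differentiable_uptoV; first by move=> x; rewrite gt_eqF.
  apply: differentiable_uptoD; first exact: differentiable_upto_flat.
  exact/differentiable_upto_affine/differentiable_upto_flat.
- by move=> x x0; rewrite flat0// mul0r.
- move=> x x1; rewrite (@flat0 (-1 * x + 1)); last lra.
  by rewrite addr0 divff// gt_eqF// flat_gt0//; lra.
- move=> x y xy; rewrite ler_pdivrMr ?den// mulrAC ler_pdivlMr ?den//.
  have h1 := flat_homo xy.
  have h2 : flat 0 (-1 * y + 1) <= flat 0 (-1 * x + 1) by apply: flat_homo; lra.
  rewrite !mulrDr [flat 0 y * flat 0 x]mulrC lerD2l.
  by rewrite ler_pM ?flat_ge0.
Qed.

End smooth_step.

(** * Testing the weak derivative against a smoothed plateau *)

Section L2norm.
Context {R : realType}.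
Implicit Types (f : R -> R) (D : set R).
Local Notation mu := lebesgue_measure.

Lemma integral_sqr_L2norm D f : measurable D -> (L2norm_on D f < +oo)%E ->
  (\int[mu]_(x in D) (f x ^+ 2)%:E = (fine (L2norm_on D f) ^+ 2)%:E)%E.
Proof.
move=> mD Lf; have L0 : (0 <= L2norm_on D f)%E by exact: Lnorm_ge0.
have Lfin : L2norm_on D f \is a fin_num by rewrite ge0_fin_numE.
have := @powR_Lnorm _ _ R mu (EFin \o (f \_ D)) 2 (ltac:(by [])).
rewrite -[Lnorm _ _ _]/(L2norm_on D f) -(fineK Lfin) poweR_EFin powR_mulrn ?fine_ge0// => ->.
rewrite [LHS]integral_mkcond; apply: eq_integral => x _.
rewrite /patch/=; case: ifPn => xD; last by rewrite normr0 powR0.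
by rewrite powR_mulrn// real_normK// num_real.
Qed.

Lemma L2norm_within_fin (a b : R) f : {within `[a, b], continuous f} ->
  (L2norm_on `[a, b] f < +oo)%E.
Proof.
move=> cf; rewrite /L2norm_on unlock.
have -> : (\int[mu]_x `|(EFin \o (f \_ `[a, b])) x| `^ 2 =
           \int[mu]_(x in `[a, b]) (f x ^+ 2)%:E)%E.
  rewrite [RHS]integral_mkcond; apply: eq_integral => x _.
  rewrite /patch/=; case: ifPn => xD; last by rewrite normr0 powR0.
  by rewrite powR_mulrn// real_normK// num_real.
have : (\int[mu]_(x in `[a, b]) (f x ^+ 2)%:E)%E \is a fin_num.
  apply: integrable_fin_num => //; apply: (@integrable_within _ _ _ (fun x => f x ^+ 2)).
  by rewrite (_ : (fun x => _) = (fun x => f x * f x)) //; exact: within_continuousM.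
by move=> /fineK <-; rewrite poweR_EFin ltry.
Qed.

End L2norm.

Section weak_derivative_tests.
Context {R : realType}.
Implicit Types (f Df phi : R -> R) (a b c e : R).
Local Notation mu := lebesgue_measure.

Lemma within_continuous_dist a b f c e : {within `[a, b], continuous f} ->
  a <= c -> c <= b -> 0 < e ->
  exists2 d : R, 0 < d & forall x, a <= x -> x <= b -> `|x - c| < d -> `|f x - f c| <= e.
Proof.
move=> cf ac cb e0.
have := cf c; rewrite /continuous_at => /cvgrPdist_le /(_ e e0).
have cab : `[a, b]%classic c by rewrite /= in_itv/= ac.
rewrite /nbhs/= -nbhs_subspace_in// => -[d d0 hd]; exists d => // x ax xb xc.
rewrite distrC; apply: hd => /=; last by rewrite in_itv/= ax.
by rewrite /ball/= distrC.
Qed.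

(** The derivative of a rescaled step is a nonnegative bump of integral 1
    carried by [a, a + e]; integrating f against it is an average of f there. *)
Lemma Rintegral_step_deriv (S : R -> R) f a e (n : R) :
  (forall n, differentiable_upto n S) -> (forall x : R, x <= 0 -> S x = 0) ->
  (forall x : R, 1 <= x -> S x = 1) -> {homo S : x y / x <= y} ->
  {within `[0, pi], continuous f} -> 0 < e -> 0 <= a -> a + e <= pi ->
  (forall x, a <= x -> x <= a + e -> `|f x - f a| <= n) ->
  `|\int[mu]_(x in `[0, pi]) (f x * (derive1 S (e^-1 * x + - (e^-1 * a)) * e^-1)) - f a| <= n.
Proof.
move=> dS S0 S1 Sh cf e0 a0 aepi fn.
pose s x := derive1 S (e^-1 * x + - (e^-1 * a)) * e^-1.
have eV : 0 < e^-1 by rewrite invr_gt0.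
have argE x : e^-1 * x + - (e^-1 * a) = (x - a) / e.
  by rewrite mulrBl [e^-1 * x]mulrC [e^-1 * a]mulrC.
have dS1 x : is_derive x (1 : R) S (derive1 S x).
  by apply: is_derive_derive1; case: (dS 1%N).
have cdS : continuous (derive1 S).
  move=> x; apply: differentiable_continuous; apply/derivable1_diffP.
  by case: (dS 2%N) => _ [+ _]; apply.
have caff : continuous (fun x : R => e^-1 * x + - (e^-1 * a)).
  move=> x; apply: cvgD; last exact: cvg_cst.
  exact: mulrl_continuous.
have cs : continuous s.
  move=> x; apply: cvgM; last exact: cvg_cst.
  exact: (@continuous_comp _ _ _ (fun x : R => e^-1 * x + - (e^-1 * a))
    (derive1 S) x (caff x) (cdS _)).
have dF (x : R) : is_derive x (1 : R) (fun x => S (e^-1 * x + - (e^-1 * a))) (s x).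
  have h : is_derive x (1 : R) (fun x => e^-1 * x + - (e^-1 * a)) e^-1.
    by apply: is_derive_eq; rewrite /GRing.scale/=; ring.
  exact: (@is_derive1_comp _ S _ x _ _ (dS1 _) h).
have dS_ge0 x : 0 <= derive1 S x.
  rewrite derive1E; apply: limr_ge; first by case: (dS1 x).
  near=> h => /=; rewrite /GRing.scale/= mulr1.
  have h0 : h != 0 by near: h; exact: nbhs_dnbhs_neq.
  case: (ltgtP h 0) h0 => // h0 _.
    rewrite -mulrNN -invrN mulr_ge0 ?invr_ge0 ?oppr_ge0 ?(ltW h0)// subr_le0.
    by apply: Sh; rewrite gerDr ltW.
  by rewrite mulr_ge0 ?invr_ge0 ?(ltW h0)// subr_ge0 Sh// lerDr ltW.
have s_ge0 x : 0 <= s x by rewrite mulr_ge0// ltW.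
have s_eq0 x : (x < a) || (a + e < x) -> s x = 0.
  move=> xae; apply/eqP; rewrite mulf_eq0; apply/orP; left; apply/eqP.
  rewrite derive1E argE; case/orP: xae => xa.
    have x0 : (x - a) / e < 0 by rewrite pmulr_llt0// subr_lt0.
    rewrite (@near_eq_derive _ _ _ S (cst 0)) ?derive_cst//.
    by near=> y; apply: S0; apply/ltW; near: y; exact: lt_nbhsl.
  have x1 : 1 < (x - a) / e by rewrite ltr_pdivlMr// mul1r; lra.
  rewrite (@near_eq_derive _ _ _ S (cst 1)) ?derive_cst//.
  by near=> y; apply: S1; apply/ltW; near: y; exact: lt_nbhsr.
have Is : \int[mu]_(x in `[0, pi]) s x = 1.
  rewrite (Rintegral_derive1 (pi_gt0 R) cs dF) !argE S1; last first.
    by rewrite ler_pdivlMr// mul1r; lra.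
  by rewrite S0 ?subr0// pmulr_lle0// sub0r oppr_le0.
have cws : {within `[0, pi], continuous s} by exact: continuous_subspaceT.
have cst_cont (v : R) : {within `[0, pi : R], continuous (fun=> v : R)}.
  by apply: continuous_subspaceT => x; exact: cvg_cst.
have cfs : {within `[0, pi], continuous (fun x => f x * s x)} by exact: within_continuousM.
have -> : \int[mu]_(x in `[0, pi]) (f x * s x) - f a =
    \int[mu]_(x in `[0, pi]) ((f x - f a) * s x).
  rewrite -[in LHS](mulr1 (f a)) -Is -RintegralZl//; last exact: integrable_within.
  rewrite -RintegralB//; last 2 first.
  - exact: integrable_within.
  - exact/integrable_within/(within_continuousM (cst_cont (f a)) cws).
  by apply: eq_Rintegral => x _; rewrite mulrBl.
have cd : {within `[0, pi], continuous (fun x => (f x - f a) * s x)}.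
  exact: (within_continuousM (within_continuousD cf (cst_cont (- f a))) cws).
apply: le_trans (le_normr_Rintegral _ (integrable_within cd)) _ => //.
have -> : n = \int[mu]_(x in `[0, pi]) (n * s x).
  by rewrite RintegralZl ?Is ?mulr1//; exact: integrable_within.
apply: le_Rintegral => //.
- by apply: integrable_within => x; apply: cvg_norm; exact: cd.
- exact/integrable_within/(within_continuousM (cst_cont n) cws).
move=> x _; rewrite normrM (ger0_norm (s_ge0 x)).
have [xa|ax] := ltP x a; first by rewrite s_eq0 ?xa// !mulr0.
have [xa|xae] := ltP (a + e) x; first by rewrite s_eq0 ?xa ?orbT// !mulr0.
by rewrite ler_wpM2r// fn.
Unshelve. all: by end_near. Qed.
Lemma closure_support_sub phi p q : (forall x, (x < p) || (q < x) -> phi x = 0) ->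
  closure [set x | phi x != 0] `<=` `[p, q].
Proof.
move=> phi0; have -> : `[p, q]%classic = closure `[p, q]%classic.
  by apply/closure_id; exact: interval_closed.
apply: closureS => x /= phix; rewrite in_itv/=; apply/negPn/negP.
by rewrite negb_and -!ltNge => /phi0 /eqP; rewrite (negbTE phix).
Qed.

Lemma test_function_interval phi p q : (forall n, differentiable_upto n phi) ->
  (forall x, (x < p) || (q < x) -> phi x = 0) -> 0 < p -> q < pi ->
  test_function `]0, pi[ phi.
Proof.
move=> dphi phi0 p0 qpi; have sub := closure_support_sub phi0; split.
- exact: derivable_derive1n.
- apply: (@subclosed_compact _ _ `[p, q]) => //; first exact: closed_closure.
  exact: segment_compact.
- move=> x /sub /=; rewrite !in_itv/= => /andP[px xq]; apply/andP; split; lra.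
Qed.

Lemma Rintegral_oo_cc f a b : {within `[a, b], continuous f} ->
  \int[mu]_(x in `]a, b[) f x = \int[mu]_(x in `[a, b]) f x.
Proof.
move=> cf; have icf := integrable_within cf.
rewrite Rintegral_itv_obnd_cbnd ?Rintegral_itv_bndo_bndc//.
- by apply: integrableS icf => //; exact: subset_itv_co_cc.
- by apply: integrableS icf => //; exact: subset_itv_oo_cc.
Qed.

(** Integrate the inequality |uv| <= (l u^2 + v^2 / l) / 2. Keeping l free
    postpones the optimisation that would give the Cauchy-Schwarz inequality. *)
Lemma norm_Rintegral_mul_le Df phi p q (l : R) : 0 < l -> p <= q ->
  measurable_fun `]0, pi[ Df -> (L2norm_on `[0%R, pi] Df < +oo)%E ->
  continuous phi -> (forall x, `|phi x| <= 1) ->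
  (forall x, (x < p) || (q < x) -> phi x = 0) ->
  `|\int[mu]_(x in `]0, pi[) (Df x * phi x)| <=
    (l * fine (L2norm_on `[0, pi] Df) ^+ 2 + (q - p) / l) / 2.
Proof.
move=> l0 pq mDf LDf cphi phi1 phi0; set A := fine _.
have mI : measurable (`]0, pi[%classic : set R) by exact: measurable_itv.
have mphi : measurable_fun (`]0, pi[ : set R) phi.
  apply: (measurable_realfun.subspace_continuous_measurable_fun mI).
  exact: continuous_subspaceT.
have mDf2 : measurable_fun `]0, pi[ (fun x => Df x ^+ 2).
  exact: measurable_realfun.measurable_funX.
have mphi2 : measurable_fun (`]0, pi[ : set R) (fun x => phi x ^+ 2).
  exact: measurable_realfun.measurable_funX.
have IDf : (\int[mu]_(x in `]0%R, pi[) (Df x ^+ 2)%:E <= (A ^+ 2)%:E)%E.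
  rewrite -(integral_sqr_L2norm _ LDf)//; apply: ge0_subset_integral => //.
  - apply/measurable_realfun.measurable_EFinP.
    exact: (@measurable_realfun.measurable_fun_itv_cc _ _ _ _ _ _ mDf2).
  - by move=> x _; rewrite lee_fin sqr_ge0.
  - exact: subset_itv_oo_cc.
have iDf2 : mu.-integrable `]0, pi[ (EFin \o (fun x => Df x ^+ 2)).
  apply/integrableP; split; first exact/measurable_realfun.measurable_EFinP.
  under eq_integral do rewrite /= ger0_norm ?sqr_ge0//.
  exact: le_lt_trans IDf (ltry _).
have iphi2 : mu.-integrable `]0, pi[ (EFin \o (fun x => phi x ^+ 2)).
  have : mu.-integrable `[0, pi] (EFin \o (fun x => phi x ^+ 2)).
    apply: (@integrable_within _ _ _ (fun x => phi x ^+ 2)); apply: continuous_subspaceT => x.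
    exact: (@cvgM _ _ _ _ phi phi (phi x) (phi x) (cphi x) (cphi x)).
  by apply: integrableS => //; exact: subset_itv_oo_cc.
have Iphi : \int[mu]_(x in `]0, pi[) (phi x ^+ 2) <= q - p.
  have -> : \int[mu]_(x in `]0, pi[) (phi x ^+ 2) =
      \int[mu]_(x in `]0, pi[ `&` `[p, q]) (phi x ^+ 2).
    rewrite Rintegral_mkcondr; apply: eq_Rintegral => x _.
    rewrite /patch; case: ifPn => //; rewrite notin_setE/= in_itv/= => /negP.
    by rewrite negb_and -!ltNge => /phi0 ->; rewrite expr0n.
  have -> : q - p = 1 * (q - p) by rewrite mul1r.
  rewrite -(Rintegral_const _ pq).
  have i1 : mu.-integrable `[p, q] (EFin \o (fun=> 1 : R)).
    by apply: integrable_within; apply: continuous_subspaceT => x; exact: cvg_cst.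
  apply: (@le_trans _ _ (\int[mu]_(x in `]0, pi[ `&` `[p, q]) 1)).
    apply: le_Rintegral => //; first exact: measurableI.
    - by apply: integrableS iphi2 => //; exact: measurableI.
    - by apply: integrableS i1 => //; exact: measurableI.
    - by move=> x _; rewrite -real_normK ?num_real// expr_le1.
  rewrite fine_le//; try apply: integrable_fin_num => //.
  - exact: measurableI.
  - by apply: integrableS i1 => //; exact: measurableI.
  by apply: ge0_subset_integral => //; exact: measurableI.
have young x : `|Df x * phi x| <= (l / 2) * Df x ^+ 2 + (1 / (2 * l)) * phi x ^+ 2.
  have h : 0 <= (l * `|Df x| - `|phi x|) ^+ 2 by exact: sqr_ge0.
  rewrite normrM -(real_normK (num_real (Df x))) -(real_normK (num_real (phi x))).
  move: h; move: `|Df x| `|phi x| => u v h.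
  rewrite -subr_ge0; have -> : l / 2 * u ^+ 2 + 1 / (2 * l) * v ^+ 2 - u * v =
    (l * u - v) ^+ 2 / (2 * l) by field; rewrite gt_eqF.
  by rewrite divr_ge0// mulr_ge0// ltW.
have iZ (c : R) (g : R -> R) : mu.-integrable `]0, pi[ (EFin \o g) ->
    mu.-integrable `]0, pi[ (EFin \o (fun x => c * g x)).
  by move=> ig; exact: (@integrableZl _ _ _ mu `]0, pi[ (measurable_itv _) c _ ig).
have iY : mu.-integrable `]0, pi[
    (EFin \o (fun x => (l / 2) * Df x ^+ 2 + (1 / (2 * l)) * phi x ^+ 2)).
  exact: (@integrableD _ _ _ mu `]0, pi[ (measurable_itv _) _ _ (iZ (l / 2) _ iDf2)
    (iZ (1 / (2 * l)) _ iphi2)).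
have iDP : mu.-integrable `]0, pi[ (EFin \o (fun x => Df x * phi x)).
  apply: le_integrable iY => //.
    exact/measurable_realfun.measurable_EFinP/measurable_realfun.measurable_funM.
  by move=> x _; rewrite /= lee_fin (le_trans (young x))// ler_norm.
apply: le_trans (le_normr_Rintegral _ iDP) _ => //.
have iN : mu.-integrable `]0, pi[ (EFin \o (fun x => `|Df x * phi x|)).
  by have := integrable_norm iDP.
apply: le_trans (le_Rintegral _ iN iY (fun x _ => young x)) _ => //.
rewrite RintegralD//; [|exact: iZ|exact: iZ].
rewrite !RintegralZl//.
have I2 : \int[mu]_(x in `]0, pi[) (Df x ^+ 2) <= A ^+ 2.
  rewrite -lee_fin fineK//; exact: integrable_fin_num.
have h1 : l / 2 * \int[mu]_(x in `]0, pi[) (Df x ^+ 2) <= l / 2 * A ^+ 2.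
  by rewrite ler_wpM2l// divr_ge0// ltW.
have h2 : 1 / (2 * l) * \int[mu]_(x in `]0, pi[) (phi x ^+ 2) <= 1 / (2 * l) * (q - p).
  by rewrite ler_wpM2l// divr_ge0// mulr_ge0// ltW.
have -> : (l * A ^+ 2 + (q - p) / l) / 2 = l / 2 * A ^+ 2 + 1 / (2 * l) * (q - p).
  by field; rewrite gt_eqF.
exact: lerD.
Qed.

End weak_derivative_tests.

(** * The Hoelder estimate *)

Section hoelder_estimate.
Context {R : realType}.
Implicit Types (f Df phi : R -> R) (a b c e : R).
Local Notation mu := lebesgue_measure.

(** The test function is a step at a minus a step at b, both of width e. As e
    tends to 0 the two pairings of f with its derivative tend to f a and f b. *)
Lemma weak_derivative_increment f Df a b (l : R) :
  {within `[0, pi], continuous f} -> is_weak_derivative `]0, pi[ f Df ->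
  (L2norm_on `[0%R, pi] Df < +oo)%E -> 0 < a -> a < b -> b < pi -> 0 < l ->
  `|f b - f a| <= (l * fine (L2norm_on `[0, pi] Df) ^+ 2 + (b - a) / l) / 2.
Proof.
move=> cf [_ [mDf _ _] wDf] LDf a0 ab bpi l0.
suff H (t : R) : 0 < t ->
    `|f b - f a| <= (l * fine (L2norm_on `[0, pi] Df) ^+ 2 + (b - a) / l) / 2 + t.
  by apply/ler_addgt0Pr.
move=> t0.
have [S [dS S0 S1 Sh]] := @exists_smooth_step R.
have t4 : 0 < t / 4 by lra.
have [da da0 fa] := within_continuous_dist cf (ltW a0) (ltW (lt_trans ab bpi)) t4.
have [db db0 fb] := within_continuous_dist cf (ltW (lt_trans a0 ab)) (ltW bpi) t4.
have [e [e0 eda edb ebpi elt]] : exists e : R, [/\ 0 < e, e < da, e < db, b + e < pi & e / l <= t].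
  exists (Num.min (Num.min da db) (Num.min (pi - b) (t * l)) / 2).
  set m := Num.min _ _; have m0 : 0 < m.
    by rewrite !lt_min da0 db0 subr_gt0 bpi mulr_gt0.
  have : m <= m by []; rewrite {2}/m !le_min => /andP[/andP[h1 h2] /andP[h3 h4]].
  by split; rewrite ?ler_pdivrMr//; lra.
have eV : 0 < e^-1 by rewrite invr_gt0.
pose st c x := S (e^-1 * x + - (e^-1 * c)).
have stE c x : st c x = S ((x - c) / e).
  by rewrite /st; congr S; rewrite mulrBl [e^-1 * x]mulrC [e^-1 * c]mulrC.
(* A plateau of height 1 carried by [a, b + e]. *)
pose phi x := st a x + -1 * st b x.
have dst c n : differentiable_upto n (st c) by exact: differentiable_upto_affine.
have dphi n : differentiable_upto n phi.
  apply: differentiable_uptoD => //; apply: differentiable_uptoM => //.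
  exact: differentiable_upto_cst.
have phi0 x : (x < a) || (b + e < x) -> phi x = 0.
  rewrite /phi !stE => /orP[xa|bx].
    by rewrite !S0 ?mulr0 ?addr0// pmulr_lle0//; lra.
  by rewrite !S1 ?mulr1 ?subrr// ler_pdivlMr// mul1r; lra.
have S01 x : 0 <= S x <= 1.
  apply/andP; split.
    have [x0|x0] := leP x 0; first by rewrite S0.
    by rewrite -(S0 0)//; apply/Sh/ltW.
  have [x1|x1] := leP 1 x; first by rewrite S1.
  by rewrite -(S1 1)//; apply/Sh/ltW.
have phi1 x : `|phi x| <= 1.
  have := S01 ((x - a) / e); have := S01 ((x - b) / e).
  rewrite /phi !stE mulN1r ler_norml => /andP[? ?] /andP[? ?].
  by apply/andP; split; lra.
have cphi : continuous phi.
  by move=> x; apply: differentiable_continuous; apply/derivable1_diffP; case: (dphi 1%N).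
pose s c x := derive1 S (e^-1 * x + - (e^-1 * c)) * e^-1.
have dphiE : derive1 phi = (fun x => s a x - s b x).
  have dS1 x : is_derive x (1 : R) S (derive1 S x).
    by apply: is_derive_derive1; case: (dS 1%N).
  have dF c (x : R) : is_derive x (1 : R) (st c) (s c x).
    have h : is_derive x (1 : R) (fun x => e^-1 * x + - (e^-1 * c)) e^-1.
      by apply: is_derive_eq; rewrite /GRing.scale/=; ring.
    exact: (@is_derive1_comp _ S _ x _ _ (dS1 _) h).
  apply/funext => x; rewrite derive1E.
  have h := is_deriveD (dF a x) (is_deriveZ (-1) (dF b x)).
  have -> : phi = st a + (-1) \*: st b by apply/funext => y; rewrite /phi.
  by case: h => _ ->; rewrite /GRing.scale/= mulN1r.
have cs c : {within `[0, pi : R], continuous (s c)}.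
  have cdS : continuous (derive1 S).
    move=> x; apply: differentiable_continuous; apply/derivable1_diffP.
    by case: (dS 2%N) => _ [+ _]; apply.
  apply: continuous_subspaceT => x; apply: cvgM; last exact: cvg_cst.
  have caff : e^-1 * y + - (e^-1 * c) @[y --> x] --> e^-1 * x + - (e^-1 * c).
    by apply: cvgD; [exact: mulrl_continuous|exact: cvg_cst].
  exact: (@continuous_comp _ _ _ (fun x : R => e^-1 * x + - (e^-1 * c)) (derive1 S) x caff (cdS _)).
have := wDf phi (test_function_interval dphi phi0 a0 ebpi).
have cfs c : {within `[0, pi], continuous (fun x => f x * s c x)} by exact: within_continuousM.
have -> : \int[mu]_(x in `]0, pi[) (f x * derive1 phi x) =
    \int[mu]_(x in `[0, pi]) (f x * s a x) - \int[mu]_(x in `[0, pi]) (f x * s b x).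
  rewrite Rintegral_oo_cc; last first.
    apply: within_continuousM => //; rewrite dphiE => x.
    by apply: cvgB; exact: cs.
  rewrite -RintegralB//; try exact: integrable_within.
  by apply: eq_Rintegral => x _; rewrite dphiE mulrBr.
have ha : `|\int[mu]_(x in `[0, pi]) (f x * s a x) - f a| <= t / 4.
  apply: (Rintegral_step_deriv dS S0 S1 Sh cf e0 (ltW a0)); first lra.
  move=> x ax xa; apply: fa; try lra.
  by rewrite ger0_norm; lra.
have hb : `|\int[mu]_(x in `[0, pi]) (f x * s b x) - f b| <= t / 4.
  apply: (Rintegral_step_deriv dS S0 S1 Sh cf e0 (ltW (lt_trans a0 ab)) (ltW ebpi)).
  move=> x bx xb; apply: fb; try lra.
  by rewrite ger0_norm; lra.
have abe : a <= b + e by lra.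
have := norm_Rintegral_mul_le l0 abe mDf LDf cphi phi1 phi0.
move: ha hb; set Ia := \int[_]_(_ in _) _; set Ib := \int[_]_(_ in _) (f _ * s b _).
set J := \int[_]_(_ in _) _; set A2 := _ ^+ 2.
clear -elt t0 => ha hb hJ E.
have JE : J = Ib - Ia by lra.
move: hJ; rewrite JE.
have -> : (b + e - a) / l = (b - a) / l + e / l by rewrite -mulrDl; congr (_ / _); ring.
move: ha hb; rewrite !ler_norml => /andP[? ?] /andP[? ?] /andP[? ?].
by apply/andP; split; lra.
Qed.

(** The interior inequality passes to the end points by continuity. Taking
    l = |f b - f a| / A^2 yields the square root. *)
Lemma hoelder_half f Df a b :
  {within `[0, pi], continuous f} -> is_weak_derivative `]0, pi[ f Df ->
  (L2norm_on `[0%R, pi] Df < +oo)%E -> 0 <= a -> a <= b -> b <= pi ->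
  `|f b - f a| <= fine (L2norm_on `[0, pi] Df) * Num.sqrt (b - a).
Proof.
move=> cf wf LDf a0; rewrite le_eqVlt => /predU1P[<- _|ab bpi].
  by rewrite !subrr normr0 sqrtr0 mulr0.
set A := fine _; have A0 : 0 <= A by rewrite fine_ge0// Lnorm_ge0.
have young l : 0 < l -> `|f b - f a| <= (l * A ^+ 2 + (b - a) / l) / 2.
  move=> l0; suff H (t : R) : 0 < t -> `|f b - f a| <= (l * A ^+ 2 + (b - a) / l) / 2 + t.
    by apply/ler_addgt0Pr.
  move=> t0.
  have t2 : 0 < t / 2 by lra.
  have [da da0 fa] := within_continuous_dist cf a0 (le_trans (ltW ab) bpi) t2.
  have [db db0 fb] := within_continuous_dist cf (le_trans a0 (ltW ab)) bpi t2.
  pose m := Num.min (Num.min da db) (b - a).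
  have m0 : 0 < m by rewrite !lt_min da0 db0 subr_gt0.
  have : m <= m by []; rewrite {2}/m !le_min => /andP[/andP[h1 h2] h3].
  have [a' [aa' a'a a'2]] : exists a' : R, [/\ a < a', a' < a + da & a' < (a + b) / 2].
    by exists (a + m / 3); split; lra.
  have [b' [bb' b'b b'2]] : exists b' : R, [/\ b' < b, b - db < b' & (a + b) / 2 < b'].
    by exists (b - m / 3); split; lra.
  have h : `|f b' - f a'| <= (l * A ^+ 2 + (b' - a') / l) / 2.
    by apply: weak_derivative_increment => //; lra.
  have ha : `|f a' - f a| <= t / 2 by apply: fa; rewrite ?gtr0_norm; lra.
  have hb : `|f b' - f b| <= t / 2 by apply: fb; rewrite ?ltr0_norm; lra.
  have hl : (b' - a') / l <= (b - a) / l by rewrite ler_pM2r ?invr_gt0//; lra.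
  move: h ha hb; rewrite !ler_norml => /andP[? ?] /andP[? ?] /andP[? ?].
  by apply/andP; split; lra.
(* The choice of l needs a nonzero increment and a nonzero A. *)
have [X0|X0] := leP `|f b - f a| 0.
  by apply: le_trans X0 _; rewrite mulr_ge0// sqrtr_ge0.
move: young X0; set X := `|_ - _| => young X0.
have [A00|A00] := eqVneq A 0.
  have := young ((b - a) / X); rewrite A00 expr0n mulr0 add0r divr_gt0 ?subr_gt0// => /(_ isT).
  by rewrite invf_div mulrCA divff ?mulr1 ?gt_eqF ?subr_gt0//; lra.
have {A00} A1 : 0 < A by rewrite lt_neqAle eq_sym A00.
have A2 : 0 < A ^+ 2 by rewrite exprn_gt0.
have := young (X / A ^+ 2) (divr_gt0 X0 A2).
rewrite divfK ?gt_eqF// => h.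
have hX : X ^+ 2 <= A ^+ 2 * (b - a).
  have : X <= (b - a) / (X / A ^+ 2) by lra.
  rewrite ler_pdivlMr ?divr_gt0// mulrA ler_pdivrMr//; rewrite expr2; lra.
rewrite -(@ler_pXn2r _ 2)// ?nnegrE ?mulr_ge0 ?sqrtr_ge0 ?(ltW X0) ?A0//.
by rewrite exprMn sqr_sqrtr// subr_ge0 ltW.
Qed.

End hoelder_estimate.

(** * Assembling the bound *)

Section main_bound.
Context {R : realType}.
Implicit Types (f Df : R -> R) (a b c : R).
Local Notation mu := lebesgue_measure.

(** The exponent in the theorem carries one logarithm more than the bound k^-N
    needs; this surplus absorbs all constants. *)
Lemma powR_decay (k : R) (N : nat) : 1000 <= k -> N%:R <= k ^+ 2 ->
  k `^ (- (k ^+ 2 * ln k)) <= (k ^+ N)^-1.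
Proof.
move=> k1 Nk; have k0 : 0 < k by lra.
have lnk : 1 <= ln k.
  have h : 1 / 2 <= expR (- (1 / 2) : R) by have := @expR_ge1Dx R (- (1 / 2)); lra.
  have h2 : 1 / 4 <= expR (-1 : R).
    have -> : (-1 : R) = - (1 / 2) + - (1 / 2) by lra.
    by rewrite expRD; nra.
  have e4 : expR (1 : R) <= k.
    have := h2; rewrite expRN; have := expR_gt0 (1 : R).
    move: (expR 1) => E E0 h4; have : E * (1 / 4) <= E * E^-1 by rewrite ler_pM2l.
    by rewrite divff ?gt_eqF//; lra.
  by rewrite -[leLHS](@expRK R) ler_ln// posrE ?expR_gt0.
rewrite -powR_invn ?(ltW k0)//; apply: ler_powR; first lra.
rewrite lerN2; apply: le_trans Nk _.
by rewrite ler_peMr// sqr_ge0.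
Qed.

Lemma powR_log2_le1 (k : R) : 0 < k -> k `^ (- (k ^+ 2 * ln k)) <= 1.
Proof.
move=> k0; rewrite /powR gt_eqF// -(@expR0 R) ler_expR mulNr oppr_le0 -mulrA.
by rewrite mulr_ge0 ?sqr_ge0// -expr2 sqr_ge0.
Qed.

Lemma sorted_zeros f n :
  ([set x : R | (0 < x < pi)%R /\ f x = 0%R] #= `I_n)%card ->
  exists s : seq R, [/\ size s = n, path <%R 0 s,
    {in s, forall y, y < pi /\ f y = 0} &
    forall x, 0 < x -> x < pi -> f x = 0 -> x \in s].
Proof.
set Z := [set x | _] => cZ; have fZ : finite_set Z by apply/finite_setP; exists n.
exists (sort <=%O (finmap.enum_fset (fset_set Z))).
have memE x : (x \in sort <=%O (finmap.enum_fset (fset_set Z))) = (x \in Z).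
  by rewrite mem_sort; exact: in_fset_set.
split.
- by rewrite size_sort (card_fset_set cZ).
- rewrite lt_path_sortedE sort_lt_sorted finmap.fset_uniq andbT.
  by apply/allP => x; rewrite memE inE => -[/andP[]].
- by move=> x; rewrite memE inE => -[/andP[]].
- by move=> x x0 xpi fx; rewrite memE inE; split => //; rewrite x0.
Qed.

Lemma sine_coef_signr f (e : bool) n : {within `[0, pi], continuous f} ->
  `|sine_coef (fun x => (-1) ^+ e * f x) n| = `|sine_coef f n|.
Proof.
move=> cf; rewrite /sine_coef; under eq_Rintegral do rewrite -mulrA.
rewrite RintegralZl//; first by rewrite normrM normrX normrN1 expr1n mul1r.
apply: integrable_within; apply: within_continuousM => //.
apply: continuous_subspaceT => x.
by apply: continuous_comp; [exact: mulrl_continuous|exact: continuous_sin].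
Qed.

Lemma exists_max_norm f : {within `[0, pi], continuous f} ->
  exists (x0 : R) (e : bool), [/\ 0 <= x0, x0 <= pi &
    forall x, 0 <= x -> x <= pi -> `|f x| <= (-1) ^+ e * f x0].
Proof.
move=> cf; have cnf : {within `[0, pi], continuous (fun x => `|f x|)}.
  by move=> x; apply: cvg_norm; exact: cf.
have [x0] := EVT_max (pi_ge0 R) cnf; rewrite in_itv/= => /andP[x00 x0pi] fx0.
exists x0, (f x0 < 0); split => // x x1 x2; rewrite -normrEsign.
by apply: fx0; rewrite in_itv/= x1.
Qed.

Lemma L2norm_le_sup f (M : R) : {within `[0, pi], continuous f} -> 0 <= M ->
  (forall x, 0 <= x -> x <= pi -> `|f x| <= M) ->
  fine (L2norm_on `[0, pi] f) <= Num.sqrt pi * M.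
Proof.
move=> cf M0 fM; have fin := L2norm_within_fin cf.
have nu0 : 0 <= fine (L2norm_on `[0, pi] f) by rewrite fine_ge0// Lnorm_ge0.
rewrite -(@ler_pXn2r _ 2)// ?nnegrE ?mulr_ge0 ?sqrtr_ge0// exprMn sqr_sqrtr ?pi_ge0//.
have := integral_sqr_L2norm (measurable_itv _) fin.
move=> /(congr1 fine) /= <-.
have c2 : {within `[0, pi], continuous (fun x => f x ^+ 2)}.
  by rewrite (_ : (fun x => _) = (fun x => f x * f x)) //; exact: within_continuousM.
rewrite -[fine _]/(\int[mu]_(x in `[0, pi]) (f x ^+ 2)).
have -> : pi * M ^+ 2 = M ^+ 2 * (pi - 0) by rewrite subr0 mulrC.
rewrite -(Rintegral_const _ (pi_ge0 R)); apply: le_Rintegral => //.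
- exact: integrable_within.
- by apply: integrable_within; apply: continuous_subspaceT => x; exact: cvg_cst.
move=> x /=; rewrite in_itv/= => /andP[x0 xpi].
by rewrite -real_normK ?num_real// lerXn2r ?nnegrE// fM.
Qed.

(** The sine has integral 2 over [0, pi]. *)
Lemma sine_coef1_ge f (m : R) : {within `[0, pi], continuous f} ->
  (forall x, 0 <= x -> x <= pi -> m <= f x) -> 2 * m <= sine_coef f 1.
Proof.
move=> cf fm.
have csin : continuous (@sin R) by exact: continuous_sin.
have Is : \int[mu]_(x in `[0, pi]) sin x = 2 :> R.
  have dF (x : R) : is_derive x (1 : R) (fun x => - cos x) (sin x).
    by apply: is_derive_eq; rewrite opprK.
  by rewrite (Rintegral_derive1 (pi_gt0 R) csin dF) cospi cos0; lra.
rewrite -Is mulrC -RintegralZl//; last exact/integrable_within/continuous_subspaceT.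
apply: le_Rintegral => //.
- apply/integrable_within/within_continuousM; last exact: continuous_subspaceT.
  by apply: continuous_subspaceT => x; exact: cvg_cst.
- apply/integrable_within/within_continuousM => //.
  apply: continuous_subspaceT => x.
  by apply: continuous_comp; [exact: mulrl_continuous|exact: continuous_sin].
move=> x /=; rewrite in_itv/= => /andP[x0 xpi].
by rewrite mul1r ler_wpM2r ?fm// sin_ge0_pi// x0.
Qed.

(** The interval extends from the maximum point towards the middle of [0, pi], where
    there is room because r <= 1 <= pi / 2. *)
Lemma large_near_max f (A M x0 r : R) : 0 < r -> r <= 1 -> 0 <= A ->
  (forall a b, 0 <= a -> a <= b -> b <= pi -> `|f b - f a| <= A * Num.sqrt (b - a)) ->
  0 <= x0 -> x0 <= pi -> f x0 = M -> A * Num.sqrt r <= M / 2 ->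
  exists p, [/\ 0 <= p, p + r <= pi & {in `[p, p + r], forall x, M / 2 <= f x}].
Proof.
move=> r0 r1 A0 hf x00 x0pi fx0 AM; have p2 := @pi_ge2 R.
have near x : 0 <= x -> x <= pi -> `|x - x0| <= r -> M / 2 <= f x.
  move=> x1 x2 xr; have : `|f x - f x0| <= M / 2.
    apply: le_trans AM; have [xx0|xx0] := leP x0 x.
      apply: le_trans (hf _ _ x00 xx0 x2) _; rewrite ler_wpM2l// ler_wsqrtr//.
      by apply: le_trans (ler_norm _) xr.
    rewrite distrC; apply: le_trans (hf _ _ x1 (ltW xx0) x0pi) _.
    rewrite ler_wpM2l// ler_wsqrtr//; apply: le_trans xr.
    by rewrite distrC ler_norm.
  by rewrite fx0 ler_norml => /andP[? _]; lra.
have [x0h|x0h] := leP x0 (pi / 2).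
  exists x0; split => //; first lra.
  move=> x; rewrite in_itv/= => /andP[? ?]; apply: near; try lra.
  by rewrite ger0_norm; lra.
exists (x0 - r); split; try lra.
move=> x; rewrite in_itv/= => /andP[? ?]; apply: near; try lra.
by rewrite ler0_norm; lra.
Qed.

(** This strict inequality is the reason why a constant function satisfies the
    bound with room to spare: its first coefficient is 2 and its norm sqrt pi. *)
Lemma sqrt_pi_lt2 : Num.sqrt (pi : R) < 2.
Proof.
have -> : (2 : R) = Num.sqrt (2 ^+ 2) by rewrite sqrtr_sqr ger0_norm.
by rewrite ltr_sqrt// expr2; have := @pi_lt4 R; lra.
Qed.

(** The value of A / nu below which f counts as nearly constant. It is small enough
    for two purposes: near_constant_ratio * sqrt pi = (2 - sqrt pi) / 4 makes
    the first coefficient large enough, and near_constant_ratio * nu <= M / 2 keeps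
    f above M / 2 near its maximum point. *)
Definition near_constant_ratio : R := (2 - Num.sqrt pi) / (4 * Num.sqrt pi).

(** Above the near-constancy ratio, the Fejer peak serves when d is at least of order
    t^2 and the Sturm-Hurwitz argument otherwise, where t is A / nu in units of that
    ratio. The factor 1000 makes k = 1000 t large enough for k^2 to dominate 8 d and
    the inverse of the Fejer bound, and for k^4 to dominate 18 d / r. *)
Lemma sine_coef_sum_ge_of_hoelder f (A : R) d : (1 <= d)%N ->
  {within `[0, pi], continuous f} -> 0 < A ->
  (forall a b, 0 <= a -> a <= b -> b <= pi -> `|f b - f a| <= A * Num.sqrt (b - a)) ->
  ([set x : R | (0 < x < pi)%R /\ f x = 0%R] #= `I_(d.-1))%card ->
  let nu := fine (L2norm_on `[0, pi] f) in
  let k := 1000 / near_constant_ratio * (A / nu) in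
  0 < nu -> k `^ (- (k ^+ 2 * ln k)) * nu <= \sum_(1 <= n < d.+1) `|sine_coef f n|.
Proof.
move=> d1 cf A0 hf cz nu k nu0.
have [x0 [e [x00 x0pi fM]]] := exists_max_norm cf.
pose g x := (-1) ^+ e * f x.
have cg : {within `[0, pi], continuous g}.
  by apply: within_continuousM => //; apply: continuous_subspaceT => x; exact: cvg_cst.
have hg a b : 0 <= a -> a <= b -> b <= pi -> `|g b - g a| <= A * Num.sqrt (b - a).
  by move=> *; rewrite /g -mulrBr normrM normrX normrN1 expr1n mul1r hf.
have Sg m n : \sum_(m <= j < n) `|sine_coef f j| = \sum_(m <= j < n) `|sine_coef g j|.
  by apply: eq_bigr => j _; rewrite (sine_coef_signr e j cf).
have gM x : 0 <= x -> x <= pi -> `|g x| <= g x0.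
  by move=> *; rewrite /g normrM normrX normrN1 expr1n mul1r fM.
have [M ME] : exists M, M = g x0 by eexists.
rewrite -ME in gM.
have M0' : 0 <= M by apply: le_trans (gM x0 x00 x0pi).
have [s sE] : exists s : R, s = Num.sqrt pi by eexists.
have s2 : s < 2 by rewrite sE sqrt_pi_lt2.
have s0 : 0 < s by rewrite sE sqrtr_gt0 pi_gt0.
have nuM : nu <= s * M.
  by rewrite sE; apply: L2norm_le_sup => // x x1 x2; rewrite ME; exact: fM.
have M0 : 0 < M by clear -nuM nu0 s0 M0'; nra.
have M2 : nu / 2 <= M by clear -nuM s2 s0 M0; nra.
have [ep epE] : exists ep : R, ep = near_constant_ratio by eexists.
have eps4 : ep * (4 * s) = 2 - s by rewrite epE /near_constant_ratio -sE divfK// gt_eqF// mulr_gt0.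
have ep0 : 0 < ep by clear -eps4 s0 s2; nra.
have [t tE] : exists t : R, t = A / (ep * nu) by eexists.
have tA : t * (ep * nu) = A by rewrite tE divfK// gt_eqF// mulr_gt0.
have t0 : 0 < t by rewrite tE divr_gt0// mulr_gt0.
have kE : k = 1000 * t by rewrite /k tE -epE; field; rewrite !gt_eqF.
have epM : ep * nu <= M / 2 by clear -nuM eps4 s0 ep0 nu0 M0 s2; nra.
have [t1|t1] := leP t 1.
  (* f varies by at most A s, so it is at least M - A s everywhere up to sign. *)
  have AM : A <= ep * nu by rewrite -tA; clear -t1 ep0 nu0; have := mulr_gt0 ep0 nu0; nra.
  have gm x : 0 <= x -> x <= pi -> M - A * s <= g x.
    move=> x1 x2; have : `|g x - g x0| <= A * s.
      have sub z : z <= pi -> A * Num.sqrt z <= A * s.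
        by move=> zpi; rewrite sE ler_wpM2l ?(ltW A0)// ler_wsqrtr.
      have [xx0|xx0] := leP x0 x.
        by apply: le_trans (hg _ _ x00 xx0 x2) _; apply: sub; lra.
      by rewrite distrC; apply: le_trans (hg _ _ x1 (ltW xx0) x0pi) _; apply: sub; lra.
    by rewrite -ME ler_norml => /andP[? ?]; lra.
  have h1 := sine_coef1_ge cg gm.
  have hk : k `^ (- (k ^+ 2 * ln k)) <= 1 by apply: powR_log2_le1; rewrite kE; clear -t0; lra.
  apply: (@le_trans _ _ (1 * nu)); first by rewrite ler_wpM2r// ltW.
  rewrite mul1r Sg; apply: (@le_trans _ _ `|sine_coef g 1|); last first.
    exact: (@term_le_sum_nat _ (fun j => `|sine_coef g j|) 1 d.+1 1).
  apply: le_trans (ler_norm _); apply: le_trans h1.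
  have h2 : A * s <= ep * nu * s by rewrite ler_wpM2r// ltW.
  (* With nu <= s M this reduces to (s - 2)^2 >= 0. *)
  have h3 : s * (nu * (2 - s / 2)) <= s * (2 * M).
    have := mulr_ge0 (ltW nu0) (sqr_ge0 (s - 2)); clear -nuM.
    rewrite expr2; nra.
  rewrite ler_pM2l// in h3; clear -h2 h3 eps4.
  have : nu * (ep * (4 * s)) = nu * (2 - s) by rewrite eps4.
  lra.
(* The scale r = 1 / t^2 is where the Hoelder estimate keeps the variation of f below M / 2. *)
have t20 : 0 < t ^+ 2 by rewrite exprn_gt0.
have t21 : 1 <= t ^+ 2 by rewrite exprn_ege1// ltW.
pose r := (t ^+ 2)^-1.
have r0 : 0 < r by rewrite invr_gt0.
have r1 : r <= 1 by rewrite invf_le1.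
have rt : r * t ^+ 2 = 1 by rewrite mulVf// gt_eqF.
have Ar : A * Num.sqrt r <= M / 2.
  rewrite /r -exprVn sqrtr_sqr ger0_norm ?invr_ge0 ?(ltW t0)//.
  by rewrite ler_pdivrMr// -tA; clear -epM t0; nra.
have [p [p0 prpi gp]] := large_near_max r0 r1 (ltW A0) hg x00 x0pi (esym ME) Ar.
have t13 : 0 <= 13824 * t ^+ 2 by clear -t20; lra.
have := truncn_itv t13; set n := Num.truncn _ => /andP[n1 n2].
have k1 : 1000 <= k by rewrite kE; clear -t1; lra.
have k0 : 0 < k by clear -k1; lra.
have nt : n.+1%:R <= 13825 * t ^+ 2 by rewrite -natr1; clear -n1 t21; lra.
have [nd|dn] := leqP n.+1 d.+1.
  have := @sine_coef_sum_ge_of_peak _ g n.+1 p r M (ltn0Sn _) M0 r0 cg _ p0 prpi gp.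
  have gM2 : {in `[0, pi], forall x, `|g x| <= M}.
    by move=> x; rewrite in_itv/= => /andP[? ?]; exact: gM.
  have nr : 13824 <= n.+1%:R * r.
    by rewrite -(ler_pM2r t20) -mulrA rt mulr1 ltW.
  move=> /(_ gM2 nr) h.
  have hk := @powR_decay k 2 k1 (_ : 2%:R <= k ^+ 2).
  apply: (@le_trans _ _ ((k ^+ 2)^-1 * nu)).
    rewrite ler_wpM2r ?(ltW nu0)//; apply: hk; clear -k1; rewrite expr2; nra.
  apply: (@le_trans _ _ (M / (16 * n.+1%:R))).
    rewrite ler_pdivlMr ?mulr_gt0 ?ltr0n// -mulrA ler_pdivrMl ?exprn_gt0//.
    have -> : k ^+ 2 = 1000 * 1000 * t ^+ 2 by rewrite kE; ring.
    apply: (@le_trans _ _ (2 * M * (16 * (13825 * t ^+ 2)))).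
      by apply: ler_pM; rewrite ?(ltW nu0)// ?mulr_ge0//; clear -M2 nt; lra.
    clear -M0 t20; have := mulr_gt0 M0 t20; lra.
  apply: le_trans h _; rewrite Sg (@big_cat_nat _ _ _ n.+1 1 d.+1)//=.
  by rewrite lerDl sumr_ge0.
have [z [zs pz zf fz]] := sorted_zeros cz.
have zd : (size z).+1 = d by rewrite zs prednK.
have zg : {in z, forall y, y < pi /\ g y = 0}.
  by move=> y yz; have [-> fy] := zf y yz; rewrite /g fy mulr0.
have gz x : 0 < x -> x < pi -> g x = 0 -> x \in z.
  move=> x1 x2 /eqP; rewrite /g mulf_eq0 signr_eq0/= => /eqP; exact: fz.
have gp2 : {in `[p, p + r], forall x, M / 2 <= `|g x|}.
  by move=> x /gp h; rewrite (le_trans h)// ler_norm.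
have M20 : 0 < M / 2 by rewrite divr_gt0.
have := @sturm_hurwitz_ge _ g z p r (M / 2) M20 r0 r1 cg pz zg gz p0 prpi gp2.
rewrite zd -Sg; apply: le_trans.
have d0 : 0 < d%:R :> R by rewrite ltr0n.
have dt : d%:R <= 13824 * t ^+ 2.
  by apply: le_trans n1; rewrite ler_nat; move: dn; rewrite ltnS; exact: ltnW.
have k2 : k ^+ 2 = 1000 * 1000 * t ^+ 2 by rewrite kE; ring.
(* Each of the 2 d factors r / (18 d) is at least k^-4, since d is of order t^2. *)
apply: (@le_trans _ _ ((k ^+ (8 * d))^-1 * nu)).
  rewrite ler_wpM2r ?(ltW nu0)//; apply: powR_decay => //.
  by rewrite k2 natrM; clear -dt t20; lra.
have d18 : 0 < 18 * d%:R :> R by move: d0; clear; lra.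
have k4 : 0 < k ^+ 4 by exact: exprn_gt0.
have k4V : 0 < (k ^+ 4)^-1 by rewrite invr_gt0.
have rd : 0 < r / (18 * d%:R) by exact: divr_gt0.
have hb : (k ^+ 4)^-1 <= r / (18 * d%:R).
  rewrite ler_pdivlMr// ler_pdivrMl// -(ler_pM2r t20) -[leRHS]mulrA rt mulr1.
  have -> : k ^+ 4 = k ^+ 2 * k ^+ 2 by rewrite -exprD.
  rewrite k2; move: (t ^+ 2) t20 t21 dt => T T0 T1 dt; clear -T0 T1 dt.
  have h : d%:R * T <= 13824 * T * T by rewrite ler_pM2r.
  have := mulr_gt0 T0 T0; lra.
rewrite mulrC (_ : 8 * d = 4 * (2 * d))%N; last by rewrite mulnA.
rewrite (exprM k 4) -exprVn; apply: ler_pM.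
- exact: ltW.
- by rewrite exprn_ge0// ltW.
- by clear -M2 M0; lra.
- by apply: lerXn2r hb; rewrite nnegrE ltW.
Qed.

End main_bound.

Theorem theorem1 (R : realType) :
  exists c : R, 0 < c /\
    forall (d : nat) (f Df : R -> R),
      (1 <= d)%N ->
      {within `[0, pi], continuous f} ->
      is_weak_derivative `]0, pi[ f Df ->
      (0 < L2norm_on `[0%R, pi] Df)%E ->
      (L2norm_on `[0%R, pi] Df < +oo)%E ->
      ([set x : R | (0 < x < pi)%R /\ f x = 0%R] #= `I_(d.-1))%card ->
      let normf := fine (L2norm_on `[0, pi] f) in
      let normDf := fine (L2norm_on `[0, pi] Df) in
      let kappa := c * (normDf / normf) in
      powR kappa (- (kappa ^+ 2 * ln kappa)) * normf
        <= \sum_(1 <= n < d.+1) `|sine_coef f n|.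
Proof.
exists (1000 / near_constant_ratio); split.
  have s2 := @sqrt_pi_lt2 R; have s0 : 0 < Num.sqrt (pi : R) by rewrite sqrtr_gt0 pi_gt0.
  have e0 : 0 < near_constant_ratio :> R by rewrite /near_constant_ratio divr_gt0 ?subr_gt0 ?mulr_gt0.
  by rewrite divr_gt0 ?ltr0n.
move=> d f Df d1 cf wf Df0 Dfoo cz; cbv zeta.
have : 0 <= fine (L2norm_on `[0, pi] f) by rewrite fine_ge0// Lnorm_ge0.
rewrite le_eqVlt => /predU1P[nf0|nf0]; first by rewrite -nf0 mulr0 sumr_ge0.
apply: sine_coef_sum_ge_of_hoelder => //; first by rewrite fine_gt0// Df0.
by move=> a b a0 ab bpi; exact: hoelder_half.
Qed.
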